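(* Let $K$ be a field of characteristic zero, let $G$ be a simple bipartite graph on the vertex set $[d]=\{1,\ldots,d\}$ with $r$ connected components, and let $L$ be a non-empty subset of $[d]$. Let $A$ be the edge ring of $G^L$. Then: (a) $A$ has dimension $d$ if and only if $L$ contains at least one vertex of each connected component of $G$. (b) If $L$ contains at least one vertex of each connected component of $G$, then the Gauss algebra $\mathbb{G}(A)$ is generated by the monomials $$g_{V,T}=x_V\,\frac{e_T}{x_{V^c}},$$ where $V$ is a non-empty subset of $L$, $V^c=[d]\setminus V$, and $e_T=\prod_{e\in T}e$, where $T\subseteq E(G)$ satisfies (i) $G(T)$ is a forest, which may have isolated vertices as some of its connected components; (ii) each connected component of $G(T)$ contains exactly one vertex of $V$. In particular, when $|L|=1$, the cardinality of the minimal set of generators of $\mathbb{G}(A)$ is bounded by the number of spanning trees of $G$. Moreover, $g_{V,T}=g_{V,T'}$ if and only if each vertex of $G$ has the same degree in $T$ and $T'$.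
   Context: $S=K[x_1,\ldots,x_d]$. For $V\subseteq[d]$, $x_V=\prod_{i\in V}x_i$; an edge $e=\{i,j\}$ of $G$ is identified with the monomial $x_ix_j$ (so $e_T$ is a monomial, with $e_\emptyset=1$). $E(G)$ is the edge set of $G$. $G^L$ is the graph obtained from $G$ by attaching a loop at each vertex belonging to $L$. The edge ring of $G^L$ is the $K$-subalgebra $A=K[\,x_ix_j : \{i,j\}\in E(G)\,;\ x_i^2 : i\in L\,]$ of $S$. For $T\subseteq E(G)$, $G(T)$ is the graph with vertex set $V(G(T))=V(G)=[d]$ and edge set $T$; the degree of a vertex in $T$ is its degree in $G(T)$. Gauss algebra: if $A=K[g_1,\ldots,g_n]\subseteq S$ is generated by homogeneous polynomials of the same degree and $\dim A=d$, then $\mathbb{G}(A)$ is the $K$-subalgebra of $S$ generated by the $d\times d$ minors of the Jacobian matrix of $g_1,\ldots,g_n$. If the $g_i$ are monomials, then $\mathbb{G}(A)$ is generated by the monomials $(g_{i_1}\cdots g_{i_d})/(x_1\cdots x_d)$ for which the matrix of exponent vectors of $g_{i_1},\ldots,g_{i_d}$ has nonzero determinant. *)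

(* Defs.v *)
From HB Require Import structures.
From mathcomp Require Import all_boot all_order all_algebra.
From mathcomp Require Import mpoly.

Set Implicit Arguments.
Unset Strict Implicit.
Unset Printing Implicit Defensive.

Import GRing.Theory.
Local Open Scope ring_scope.

(** * Graphs on [d], with [d] rendered as ['I_d]

    A simple graph is given by its edge set, a set of 2-element sets of
    vertices.  Thus [G(T)] is simply the graph whose edge set is [T]. *)

Section Graphs.
Variable d : nat.
Implicit Types (E T : {set {set 'I_d}}) (L V : {set 'I_d}).

Definition simple_graph E := forall e, e \in E -> #|e| = 2%N.

(* [adj] is only meant for simple graphs: a singleton in [T] would be a loop. *)
Definition adj T : rel 'I_d := [rel i j | [set i; j] \in T].

Definition bipartite E :=
  exists c : 'I_d -> bool, forall i j, adj E i j -> c i != c j.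

Definition components T : {set {set 'I_d}} :=
  [set [set j | connect (adj T) i j] | i : 'I_d].

Definition degree T (i : 'I_d) : nat := #|[set e in T | i \in e]|.

(* Cycles are sequences of at least 3 distinct vertices, hence of at most [d]
   vertices; bounding the length makes the predicate boolean. *)
Definition forest T : bool :=
  [forall n : 'I_d.+1, (2 < n)%N ==>
    [forall p : n.-tuple 'I_d, ~~ ucycleb (adj T) p]].

Definition spanning_trees E : {set {set {set 'I_d}}} :=
  [set T : {set {set 'I_d}} |
    [&& T \subset E, forest T & [forall i, forall j, connect (adj T) i j]]].

Definition meets_every_component E L :=
  forall C, C \in components E -> exists2 i, i \in L & i \in C.

Definition admissible E L V T :=
  [/\ V != set0, V \subset L, T \subset E, forest T &
      forall C, C \in components T -> #|C :&: V| = 1].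

End Graphs.

(** * Krull dimension of a subring [A] of a ring [R]

    Subsets of [R] are predicates [R -> Prop]. *)

Section KrullDimension.
Variable R : comNzRingType.
Implicit Types A P : R -> Prop.

Definition prime_ideal A P :=
  [/\ forall x, P x -> A x,
      P 0,
      forall x y, P x -> P y -> P (x + y),
      forall a x, A a -> P x -> P (a * x) &
      ~ P 1 /\ forall x y, A x -> A y -> P (x * y) -> P x \/ P y].

Definition strict_subset P Q :=
  (forall x, P x -> Q x) /\ exists2 x, Q x & ~ P x.

(* a chain P_0 < P_1 < ... < P_n of primes of A *)
Definition has_prime_chain A (n : nat) :=
  exists P : nat -> R -> Prop,
    (forall i, (i <= n)%N -> prime_ideal A (P i)) /\
    (forall i, (i < n)%N -> strict_subset (P i) (P i.+1)).

Definition has_krull_dim A (n : nat) :=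
  has_prime_chain A n /\ forall m, has_prime_chain A m -> (m <= n)%N.

End KrullDimension.

(** * Subalgebras of [K[x_1, ..., x_d]] *)

Section Algebras.
Variables (K : fieldType) (d : nat).
Local Notation S := {mpoly K[d]}.
Implicit Types (A B gens : S -> Prop).

Inductive subalg gens : S -> Prop :=
| subalg_gen f : gens f -> subalg gens f
| subalg_const (c : K) : subalg gens c%:MP
| subalg_add f g : subalg gens f -> subalg gens g -> subalg gens (f + g)
| subalg_mul f g : subalg gens f -> subalg gens g -> subalg gens (f * g).

Definition generates gens A := forall f, subalg gens f <-> A f.

Definition minimal_homogeneous_generators A (s : seq S) :=
  [/\ uniq s,
      forall f, f \in s -> exists k, f \is k.-homog,
      generates (fun f => f \in s) A &
      forall s' : seq S, {subset s' <= s} -> generates (fun f => f \in s') A ->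
        {subset s <= s'}].

Definition jacobian n (g : n.-tuple S) : 'M[S]_(n, d) :=
  \matrix_(i, j) mderiv j (tnth g i).

Definition jacobian_minor n (g : n.-tuple S) (f : S) :=
  exists rows : 'I_d -> 'I_n,
    (forall i j : 'I_d, (i < j)%N -> (rows i < rows j)%N) /\
    f = \det (rowsub rows (jacobian g)).

(* [B] is the Gauss algebra of [A], computed from some presentation
   [A = K[g_1, ..., g_n]] with [g_i] homogeneous of the same degree. *)
Definition is_gauss_algebra A B :=
  has_krull_dim A d /\
  exists (n : nat) (g : n.-tuple S) (k : nat),
    [/\ forall i, tnth g i \is k.-homog,
        generates (fun f => f \in g) A &
        generates (jacobian_minor g) B].

(** [mesym1 V] is the exponent vector of [x_V]; an edge [e] is identified with
    the monomial [x_e]. *)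

Definition edge_ring_gens (E : {set {set 'I_d}}) (L : {set 'I_d}) (f : S) :=
  (exists2 e, e \in E & f = 'X_[mesym1 e]) \/
  (exists2 i, i \in L & f = 'X_i ^+ 2).

(* the edge ring of G^L *)
Definition edge_ring E L : S -> Prop := subalg (edge_ring_gens E L).

Definition gmon (V : {set 'I_d}) (T : {set {set 'I_d}}) : S :=
  'X_[mesym1 V + (\sum_(e in T) mesym1 e) - mesym1 (~: V)]%MM.

Definition gmon_gens (E : {set {set 'I_d}}) (L : {set 'I_d}) (f : S) :=
  exists V T, admissible E L V T /\ f = gmon V T.

(* Subtraction of exponent vectors is truncated; in the admissible case it is
   the genuine quotient [x_V e_T / x_{V^c}]. *)
Lemma gmonE E L V T : admissible E L V T ->
  gmon V T * 'X_[mesym1 (~: V)] =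
  'X_[mesym1 V] * \prod_(e in T) 'X_[mesym1 e].
Proof.
move=> [_ _ _ _ compT].
rewrite mprodXE -!mpolyXD submK //.
apply/mnm_lepP=> i; rewrite mnmDE mnm_sumE !mnmE inE.
case: (boolP (i \in V)) => //= niV.
set C := [set j | connect (adj T) i j].
have /compT C1 : C \in components T by apply/imsetP; exists i.
have [v] : exists v, v \in C :&: V by apply/set0Pn; rewrite -card_gt0 C1.
rewrite !inE => /andP[/connectP[[|j p] /= pth vE] vV].
  by rewrite vE (negPf niV) in vV.
case/andP: pth => eT _.
by rewrite (bigD1 [set i; j]) //= mnmE !inE eqxx.
Qed.

End Algebras.

(* Main.v *)
(** The elements of a chain of primes give algebraically independent elements
    of [A]: pick one in each step and, in a relation, repeatedly divide by the
    lowest power of the current one and pass to the next prime. Counting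
    monomials then bounds the length by [d], and by [d - 1] if a component [C]
    avoids [L], because the exponents of a monomial of [A] have the same sum
    over the two colour classes of [C]. Conversely, listing the vertices by
    decreasing distance to [L], the ideals of [A] cut out by the first [k]
    variables form a chain of length [d].

    For the Gauss algebra, every presentation of [A] by forms of equal degree
    is a linear recombination of the edge and loop monomials, so the maximal
    minors may be computed from the latter, where they are [det(a) * prod /
    (x_1 ... x_d)] with [a] the matrix of exponents. Up to signs given by the
    bipartition, [a] is an incidence matrix, and it is nonsingular exactly
    when the chosen edges form a forest with one chosen loop in each
    component. *)

Require Import Defs.
From HB Require Import structures.
From mathcomp Require Import all_boot all_order all_algebra.
From mathcomp Require Import perm mpoly.

Set Implicit Arguments.
Unset Strict Implicit.
Unset Printing Implicit Defensive.

Import GRing.Theory.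
Local Open Scope ring_scope.

(** * Forests *)

Section Forests.
Variable d : nat.
Implicit Types (T : {set {set 'I_d}}) (i j : 'I_d).

Lemma adj_sym T : ssrbool.symmetric (adj T).
Proof. by move=> i j; rewrite /adj /= setUC. Qed.

Lemma connect_adjC T : connect_sym (adj T).
Proof. exact: sym_connect_sym (adj_sym T). Qed.

Lemma connect_adjS T1 T2 i j :
  T1 \subset T2 -> connect (adj T1) i j -> connect (adj T2) i j.
Proof.
move=> sT; apply: connect_sub => a b ab; apply: connect1.
exact: (subsetP sT).
Qed.

Lemma simple_edgeP T (e : {set 'I_d}) : simple_graph T -> e \in T ->
  exists i j, i != j /\ e = [set i; j].
Proof. by move=> sT /sT/eqP/cards2P[i [j [ij ->]]]; exists i, j. Qed.

Lemma simple_adj_neq T i j : simple_graph T -> adj T i j -> i != j.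
Proof.
by move=> sT /sT; rewrite cards2; case: (i != j).
Qed.

(** A repetition-free path from [i] to [j] avoiding the edge would close up with it to a cycle. *)
Lemma forest_bridge T i j : simple_graph T -> forest T -> adj T i j ->
  ~~ connect (adj (T :\ [set i; j])) i j.
Proof.
move=> sT fT aij; apply/negP => /connectP[p0 /shortenP[p pth up _] jE].
(* The cycle has at least three vertices: a path without edges gives [i = j], and a path with one
   edge would use the deleted one. *)
have szp : (1 < size p)%N.
  case: p pth jE {up} => [|k [|//]] /=.
    by move=> _ ji; move: (simple_adj_neq sT aij); rewrite ji eqxx.
  by move=> /andP[+ _] jk; rewrite /adj /= jk !inE eqxx.
have szd : (size (i :: p) < d.+1)%N.
  by rewrite ltnS -[X in (_ <= X)%N]card_ord -(card_uniqP up) max_card.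
move/forallP: fT => /(_ (Ordinal szd)); rewrite /= ltnS szp /=.
move/forallP => /(_ (in_tuple (i :: p)))/negP; apply.
rewrite /ucycleb up andbT /= rcons_path -jE adj_sym aij andbT.
by apply: sub_path pth => a b; rewrite /adj /= !inE => /andP[].
Qed.

(** On a cycle [x, y, ...], going on from [y] around to [x] joins the ends of the edge [{x, y}]
    without using it. *)
Lemma bridge_forest T :
  (forall i j, adj T i j -> ~~ connect (adj (T :\ [set i; j])) i j) ->
  forest T.
Proof.
move=> bT; apply/forallP => n; apply/implyP => n3.
apply/forallP => -[s /= sz]; apply/negP => /andP[].
rewrite -(eqP sz) in n3.
case: s n3 {sz} => [|x [|y p]] //= szp /andP[xy pth].
rewrite !inE negb_or => /and3P[/andP[nxy xp] yp _].
have /negP := bT x y xy; apply; rewrite connect_adjC.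
apply/connectP; exists (rcons p x); last by rewrite last_rcons.
(* Every other edge of the cycle has an end outside [{x, y}], hence survives the deletion. *)
have keep (a b : 'I_d) : a \notin [set x; y] -> adj T a b || adj T b a ->
    adj (T :\ [set x; y]) a b.
  rewrite [adj T b a]adj_sym orbb /adj /= in_setD1 => na ->; rewrite andbT.
  by apply: contra na => /eqP <-; rewrite !inE eqxx.
case: p szp xp yp pth => //= z p _; rewrite !inE !negb_or.
move=> /andP[xz xp] /andP[yz yp] /andP[ayz pth].
rewrite adj_sym keep ?ayz ?orbT //=; last first.
  by rewrite !inE negb_or eq_sym xz eq_sym yz.
elim: p z xz yz xp yp pth {ayz} => [|z' p IH] z xz yz /=.
  by move=> _ _; rewrite !andbT => azx;
    rewrite keep ?azx // !inE negb_or eq_sym xz eq_sym yz.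
rewrite !inE !negb_or => /andP[xz' xp] /andP[yz' yp] /andP[azz pth].
rewrite keep ?azz //= ?IH // !inE negb_or eq_sym xz eq_sym yz //.
Qed.

End Forests.

(** * Exponent matrices *)

Section IncidenceMatrix.
Variables (K : fieldType) (d : nat).
Local Notation Ix := ({set 'I_d} + 'I_d)%type.
Implicit Types (T : {set {set 'I_d}}) (V : {set 'I_d}) (w : 'I_d -> K).

Definition gen_exp (x : Ix) : 'X_{1..d} :=
  match x with inl e => mesym1 e | inr i => (U_(i) *+ 2)%MM end.

Definition gen_set V T : {set Ix} :=
  [set x | match x with inl e => e \in T | inr i => i \in V end].

Lemma big_gen_set (R : Type) (idx : R) (op : Monoid.com_law idx)
    V T (F : Ix -> R) :
  \big[op/idx]_(x in gen_set V T) F x =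
  op (\big[op/idx]_(e in T) F (inl e)) (\big[op/idx]_(i in V) F (inr i)).
Proof.
rewrite big_sumType /=.
by congr (op _ _); apply: eq_bigl => i; rewrite inE.
Qed.

(** Vertex weights act as linear forms on exponent vectors: rows are independent once they have dual
    weights, and have rank [d] once only the zero weight kills them all. *)
Definition dot w (m : 'X_{1..d}) : K := \sum_i w i * (m i)%:R.

Lemma dot_edge w (i j : 'I_d) : i != j -> dot w (mesym1 [set i; j]) = w i + w j.
Proof.
move=> nij; rewrite /dot (bigD1 i) //= (bigD1 j) 1?eq_sym //= big1 ?addr0.
  by rewrite !mnmE !inE !eqxx orbT !mulr1.
by move=> k /andP[ki kj]; rewrite mnmE !inE (negPf ki) (negPf kj) mulr0.
Qed.

Lemma dot_loop w (i : 'I_d) : dot w (U_(i) *+ 2)%MM = w i *+ 2.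
Proof.
rewrite /dot (bigD1 i) //= big1 ?addr0.
  by rewrite mulmnE mnm1E eqxx mulr_natr.
by move=> k ki; rewrite mulmnE mnm1E eq_sym (negPf ki) mulr0.
Qed.

Definition exp_matrix n (phi : 'I_n -> Ix) : 'M[K]_(n, d) :=
  \matrix_(i, j) (gen_exp (phi i) j)%:R.

Lemma exp_matrix_dot n (phi : 'I_n -> Ix) (u : 'cV[K]_d) i :
  (exp_matrix phi *m u) i 0 = dot (fun j => u j 0) (gen_exp (phi i)).
Proof. by rewrite !mxE; apply: eq_bigr => j _; rewrite !mxE mulrC. Qed.

(** Pairing a left kernel vector with the weight dual to row [i] leaves a nonzero multiple of its
    [i]-th entry. *)
Lemma exp_matrix_free n (phi : 'I_n -> Ix) :
  (forall i, exists w, forall j, (dot w (gen_exp (phi j)) != 0) = (j == i)) ->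
  row_free (exp_matrix phi).
Proof.
move=> dual; rewrite -kermx_eq0; apply/eqP/row_matrixP => k.
rewrite row0; set u := row k _.
have uM : u *m exp_matrix phi = 0 by rewrite -row_mul mulmx_ker row0.
apply/rowP => i; have [w wi] := dual i.
have := congr1 (fun M => (M *m \col_j w j) 0 0) uM.
rewrite -mulmxA mul0mx mxE (bigD1 i) //= exp_matrix_dot big1 => [|j ji].
  rewrite addr0 [RHS]mxE (_ : dot _ _ = dot w (gen_exp (phi i))); last first.
    by apply: eq_bigr => j _; rewrite mxE.
  move/eqP; rewrite mulf_eq0 => /orP[/eqP->|]; first by rewrite mxE.
  by have := wi i; rewrite eqxx => /negPf->.
rewrite exp_matrix_dot (_ : dot _ _ = dot w (gen_exp (phi j))); last first.
  by apply: eq_bigr => l _; rewrite mxE.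
by have := wi j; rewrite (negPf ji) => /negbFE/eqP->; rewrite mulr0.
Qed.

Lemma exp_matrix_full n (phi : 'I_n -> Ix) :
  (forall w, (forall j, dot w (gen_exp (phi j)) = 0) -> forall i, w i = 0) ->
  row_full (exp_matrix phi).
Proof.
move=> inj; rewrite -cokermx_eq0; apply/eqP/matrixP => i k; rewrite [RHS]mxE.
apply: (inj (fun l => cokermx (exp_matrix phi) l k)) => j.
have := congr1 (fun M : 'M_(_, _) => M j k) (mulmx_coker (exp_matrix phi)).
by rewrite !mxE => <-; apply: eq_bigr => l _; rewrite !mxE mulrC.
Qed.

(** * Signed weights on bipartite graphs *)

Variables (c : 'I_d -> bool) (T : {set {set 'I_d}}).
Hypothesis simpleT : simple_graph T.
Hypothesis bipT : forall i j, adj T i j -> c i != c j.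
Hypothesis two_neq0 : 2%:R != 0 :> K.

(** Changing signs on one colour class turns the condition [w i + w j = 0] on an edge into equality
    of signed weights. *)
Let sg i : K := (-1) ^+ c i.

Let sg_neq0 i : sg i != 0.
Proof. by rewrite signr_eq0. Qed.

Let sg_adj i j : adj T i j -> sg j = - sg i.
Proof.
move=> /bipT; rewrite /sg; case: (c i); case: (c j) => //= _;
by rewrite ?expr0 ?expr1 ?opprK.
Qed.

Lemma dot_connect (T' : {set {set 'I_d}}) w i j : T' \subset T ->
  (forall e, e \in T' -> dot w (mesym1 e) = 0) ->
  connect (adj T') i j -> sg i * w i = sg j * w j.
Proof.
move=> sT w0 /connectP[p + ->] {j}; elim: p i => //= k p IH i /andP[ik /IH <-].
have aik : adj T i k := subsetP sT _ ik.
have := w0 _ ik; rewrite dot_edge ?(simple_adj_neq simpleT) //.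
by move/eqP; rewrite addr_eq0 => /eqP->; rewrite (sg_adj aik) mulrN mulNr.
Qed.

(** When [D] is a component, this is the kernel vector of the incidence matrix belonging to [D]. *)
Definition signed_ind (D : {set 'I_d}) : 'I_d -> K :=
  fun i => if i \in D then sg i else 0.

Lemma dot_signed_ind (D : {set 'I_d}) i j : adj T i j ->
  (i \in D) = (j \in D) ->
  dot (signed_ind D) (mesym1 [set i; j]) = 0.
Proof.
move=> aij Dij; rewrite dot_edge ?(simple_adj_neq simpleT) // /signed_ind Dij.
by case: ifP; rewrite ?addr0 // (sg_adj aij) subrr.
Qed.

Definition spanning_forest_rooted V :=
  forest T /\ forall C, C \in components T -> #|C :&: V| = 1%N.

Let comp i : {set 'I_d} := [set j | connect (adj T) i j].

Let comp_in i : comp i \in components T.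
Proof. by apply/imsetP; exists i. Qed.

Let comp_root V i : spanning_forest_rooted V ->
  exists v, comp i :&: V = [set v].
Proof. by move=> [_ /(_ _ (comp_in i))/eqP/cards1P[v Cv]]; exists v. Qed.

(** Dual to the loop at [v] is the signed indicator of its component, which has no other root. Dual
    to an edge [e] is the signed indicator of the half, cut off by deleting [e], that contains no
    root. *)
Lemma gen_set_dual V x : spanning_forest_rooted V -> x \in gen_set V T ->
  exists w, forall y, y \in gen_set V T -> (dot w (gen_exp y) != 0) = (y == x).
Proof.
move=> rV; case: x => [e|v]; rewrite inE; last first.
  move=> vV; exists (signed_ind (comp v)) => -[e|u]; rewrite inE.
    move=> /[dup] eT /(simple_edgeP simpleT)[i [j [ij eE]]].
    have aij : adj T i j by rewrite /adj /= -eE.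
    rewrite /= eE dot_signed_ind ?eqxx // !inE.
    exact: (same_connect_r (connect_adjC T) (connect1 aij)).
  move=> uV /=; rewrite dot_loop /signed_ind inE.
  have [r Cr] := comp_root v rV.
  have /set1P vr : v \in [set r] by rewrite -Cr !inE connect0.
  have -> : (inr u == inr v :> Ix) = (u == v) by [].
  have -> : connect (adj T) v u = (u == v).
    by rewrite vr -in_set1 -Cr !inE uV andbT -vr.
  case: (u == v); last by rewrite mul0rn eqxx.
  by rewrite -[sg u *+ 2]mulr_natr mulf_neq0.
move=> eT; have [i0 [j0 [_ eE0]]] := simple_edgeP simpleT eT.
have a0 : adj T i0 j0 by rewrite /adj /= -eE0.
have [r Cr] := comp_root i0 rV.
(* Name the ends so that [i] lies on the side of [e] away from the root [r]: as [e] is a bridge, [r]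
   cannot be reached from both ends. *)
have [i [j [aij nri eE]]] : exists i j,
    [/\ adj T i j, ~~ connect (adj (T :\ e)) i r & e = [set i; j]].
  have [ir|] := boolP (connect (adj (T :\ e)) i0 r); last by exists i0, j0.
  exists j0, i0; split; rewrite ?[adj T j0 i0]adj_sym 1?setUC //.
  have := forest_bridge simpleT rV.1 a0; rewrite -eE0; apply: contra.
  by rewrite [connect _ j0 r]connect_adjC; apply: connect_trans.
have ci : comp i0 = comp i.
  apply/setP => k; rewrite !inE; apply: (same_connect (connect_adjC T)).
  have : i \in e by rewrite eE !inE eqxx.
  by rewrite eE0 !inE => /orP[]/eqP->; [exact: connect0|exact: connect1].
exists (signed_ind [set k | connect (adj (T :\ e)) i k]) => -[f|v]; rewrite inE.
  move=> fT; have [fe|fe] := eqVneq f e.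
    rewrite fe eqxx /= eE dot_edge ?(simple_adj_neq simpleT) //.
    rewrite /signed_ind !inE connect0 -eE.
    have := forest_bridge simpleT rV.1 aij; rewrite -eE => /negPf->.
    by rewrite addr0 sg_neq0.
  have -> : (inl f == inl e :> Ix) = false by apply/negbTE.
  have [k [l [kl fE]]] := simple_edgeP simpleT fT.
  have akl : adj T k l by rewrite /adj /= -fE.
  rewrite /= fE dot_signed_ind ?eqxx // !inE.
  apply: (same_connect_r (connect_adjC _)); apply: connect1.
  by rewrite /adj /= -fE !inE fe.
(* A root in the half of [i] would be the root [r] of the whole component. *)
move=> vV; rewrite /= dot_loop /signed_ind inE.
have [iv|] := boolP (connect _ _ _); last by rewrite mul0rn eqxx.
have : v \in comp i0 :&: V.
  by rewrite ci !inE vV andbT (connect_adjS _ iv) // subD1set.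
by rewrite Cr => /set1P vr; rewrite -vr iv in nri.
Qed.

(** The loop forces weight [0] at the root since [2] is nonzero in [K], and the edges spread this
    over the component. *)
Lemma gen_set_ker V w : spanning_forest_rooted V ->
  (forall x, x \in gen_set V T -> dot w (gen_exp x) = 0) ->
  forall i, w i = 0.
Proof.
move=> rV w0 i; have [v Cv] := comp_root i rV.
have : v \in comp i :&: V by rewrite Cv set11.
rewrite !inE => /andP[iv vV].
have wv : w v = 0.
  have := w0 (inr v); rewrite inE /= dot_loop => /(_ vV)/eqP.
  by rewrite -mulr_natr mulf_eq0 (negPf two_neq0) orbF => /eqP.
have := dot_connect (subxx T) _ iv; move=> /(_ w) dc.
have /eqP : sg i * w i = sg v * w v.
  by apply: dc => e eT; have := w0 (inl e); rewrite inE; apply.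
by rewrite wv mulr0 mulf_eq0 (negPf (sg_neq0 i)) => /eqP.
Qed.

(** The exponent matrix of all chosen generators has independent rows and full column rank, so it is
    square. *)
Lemma card_rooted_forest V : spanning_forest_rooted V ->
  #|gen_set V T| = d.
Proof.
move=> rV; pose phi (i : 'I_#|gen_set V T|) : Ix := enum_val i.
have /eqP <- : row_free (exp_matrix phi).
  apply: exp_matrix_free => i; have [w wP] := gen_set_dual rV (enum_valP i).
  by exists w => j; rewrite wP ?enum_valP // (inj_eq enum_val_inj).
apply/eqP; apply: exp_matrix_full => w w0; apply: (gen_set_ker rV) => x xX.
by have := w0 (enum_rank_in xX x); rewrite /phi enum_rankK_in.
Qed.

Lemma exp_matrix_rooted_forest V (phi : 'I_d -> Ix) :
  spanning_forest_rooted V -> injective phi ->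
  (forall i, phi i \in gen_set V T) -> \det (exp_matrix phi) != 0.
Proof.
move=> rV injphi phiX; rewrite -unitfE -unitmxE -row_free_unit.
apply: exp_matrix_free => i; have [w wP] := gen_set_dual rV (phiX i).
by exists w => j; rewrite wP // (inj_eq injphi).
Qed.

Lemma exp_matrix_unit_dual (phi : 'I_d -> Ix) k :
  \det (exp_matrix phi) != 0 ->
  exists w, forall i, dot w (gen_exp (phi i)) = (i == k)%:R.
Proof.
rewrite -unitfE -unitmxE => uM.
exists (fun j => (invmx (exp_matrix phi)) j k) => i.
have := congr1 (fun M : 'M_(_, _) => M i k) (mulmxV uM).
by rewrite !mxE => <-; apply: eq_bigr => l _; rewrite !mxE mulrC.
Qed.

Lemma exp_matrix_unit_ker (phi : 'I_d -> Ix) w :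
  \det (exp_matrix phi) != 0 ->
  (forall i, dot w (gen_exp (phi i)) = 0) -> forall i, w i = 0.
Proof.
rewrite -unitfE -unitmxE => uM w0 i.
have M0 : exp_matrix phi *m \col_j w j = 0.
  apply/colP => k; rewrite exp_matrix_dot [RHS]mxE -[RHS](w0 k).
  by apply: eq_bigr => l _; rewrite mxE.
have := congr1 (fun u : 'cV_d => u i 0) (mulKmx uM (\col_j w j)).
by rewrite M0 mulmx0 !mxE.
Qed.

(** Invertibility supplies a dual weight for each chosen generator and excludes nonzero weights
    killing all of them. *)
Lemma rooted_forest_of_det V (phi : 'I_d -> Ix) :
  \det (exp_matrix phi) != 0 ->
  (forall x, x \in gen_set V T <-> exists i, x = phi i) ->
  spanning_forest_rooted V.
Proof.
move=> uM X_phi.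
have phiX i : phi i \in gen_set V T by apply/X_phi; exists i.
have dual x : x \in gen_set V T -> exists w,
    dot w (gen_exp x) = 1 /\
    forall y, y \in gen_set V T -> y != x -> dot w (gen_exp y) = 0.
  move=> /X_phi[k ->]; have [w wP] := exp_matrix_unit_dual k uM.
  exists w; split=> [|y /X_phi[i ->] ik]; first by rewrite wP eqxx.
  by rewrite wP (_ : (i == k) = false) //; apply: contraNF ik => /eqP->.
split.
  (* If the ends stay connected without the edge, the weight dual to it, which kills the other
     edges, satisfies [w i + w j = 0] and kills this edge too. *)
  apply: bridge_forest => i j aij; apply/negP => cij.
  have eX : inl [set i; j] \in gen_set V T by rewrite inE.
  have [w [w1 w0]] := dual _ eX.
  have := @dot_connect (T :\ [set i; j]) w i j (subD1set _ _).
  have e0 e : e \in T :\ [set i; j] -> dot w (mesym1 e) = 0.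
    rewrite in_setD1 => /andP[ne eT]; apply: (w0 (inl e)) => //; by rewrite inE.
  move=> /(_ e0 cij); rewrite (sg_adj aij) mulNr => /eqP.
  rewrite -subr_eq0 opprK -mulrDr mulf_eq0 (negPf (sg_neq0 i)) /= => /eqP wij.
  move: w1; rewrite /= dot_edge ?(simple_adj_neq simpleT) // wij => /eqP.
  by rewrite eq_sym oner_eq0.
move=> C /imsetP[i _ ->{C}]; rewrite -/(comp i); apply/eqP/cards1P.
have [v] : exists v, v \in comp i :&: V.
  (* The signed indicator of a component without root would be a nonzero weight killing all rows. *)
  apply/set0Pn/eqP => C0.
  have := @exp_matrix_unit_ker phi (signed_ind (comp i)) uM.
  have w0 k : dot (signed_ind (comp i)) (gen_exp (phi k)) = 0.
    have := phiX k; case: (phi k) => [e|u]; rewrite inE /=.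
      move=> /[dup] eT /(simple_edgeP simpleT)[a [b [ab eE]]].
      have aab : adj T a b by rewrite /adj /= -eE.
      rewrite eE dot_signed_ind // !inE.
      exact: (same_connect_r (connect_adjC T) (connect1 aab)).
    move=> uV; rewrite dot_loop /signed_ind; case: ifP; rewrite ?mul0rn // => ui.
    by have := in_set0 u; rewrite -C0 inE ui uV.
  move=> /(_ w0 i)/eqP; rewrite /signed_ind inE connect0.
  by rewrite (negPf (sg_neq0 i)).
rewrite inE => /andP[vi vV]; exists v; apply/setP => u; rewrite in_set1.
apply/idP/eqP => [|->]; last by rewrite inE vi.
(* With two roots [u] and [v] in a component, the weight dual to the loop at [u] vanishes at [v],
   hence along the edges also at [u]. *)
rewrite inE => /andP[ui uV]; apply/eqP/negPn/negP => uv.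
have uX : inr u \in gen_set V T by rewrite inE.
have [w [w1 w0]] := dual _ uX.
have wv : w v = 0.
  have := w0 (inr v); rewrite inE /= dot_loop => /(_ vV).
  rewrite (_ : inr v != inr u :> Ix); last by rewrite eq_sym in uv.
  by move=> /(_ isT)/eqP;
    rewrite -mulr_natr mulf_eq0 (negPf two_neq0) orbF => /eqP.
have cuv : connect (adj T) u v.
  rewrite !inE in ui vi; apply: connect_trans vi.
  by rewrite connect_adjC.
have := @dot_connect T w u v (subxx T).
have e0 e : e \in T -> dot w (mesym1 e) = 0.
  by move=> eT; apply: (w0 (inl e)) => //; rewrite inE.
move=> /(_ e0 cuv)/eqP;
  rewrite wv mulr0 mulf_eq0 (negPf (sg_neq0 u)) /= => /eqP wu.
move: w1; rewrite /= dot_loop wu mul0rn => /eqP.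
by rewrite eq_sym oner_eq0.
Qed.

End IncidenceMatrix.

(** * Chains of primes in subalgebras of polynomial rings *)

Section KrullBound.
Variables (K : fieldType) (d : nat).
Local Notation S := {mpoly K[d]}.
Implicit Types (A P : S -> Prop) (x : nat -> S).

Lemma mpoly_dependent n (f : 'I_n -> S) (Q : seq 'X_{1..d}) :
  (forall i, {subset msupp (f i) <= Q}) -> (size Q < n)%N ->
  exists2 u : 'rV[K]_n, u != 0 & \sum_i u 0 i *: f i = 0.
Proof.
move=> fQ szQ; pose M : 'M[K]_(n, size Q) :=
  \matrix_(i, j) (f i)@_(nth 0%MM Q j).
have kM : kermx M != 0.
  rewrite kermx_eq0 -row_leq_rank -ltnNge.
  exact: leq_ltn_trans (rank_leq_col M) szQ.
have /rowV0Pn[u /sub_kermxP uM u0] := kM.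
exists u => //; apply/mpolyP => m; rewrite raddf_sum mcoeff0 /=.
have [mQ|mQ] := boolP (m \in Q); last first.
  apply: big1 => i _; rewrite mcoeffZ memN_msupp_eq0 ?mulr0 //.
  by apply: contra mQ; apply: fQ.
have lt_m : (index m Q < size Q)%N by rewrite index_mem.
have := congr1 (fun v : 'rV_(size Q) => v 0 (Ordinal lt_m)) uM.
rewrite !mxE => um; rewrite -[RHS]um; apply: eq_bigr => i _.
by rewrite mcoeffZ mxE /= nth_index.
Qed.

(** * Independence of elements picked along a chain of primes *)

Fixpoint words N m : seq (seq nat) :=
  if m is m'.+1 then [seq t :: s | t <- iota 0 N, s <- words N m']
  else [:: [::]].

Lemma size_words N m : size (words N m) = (N ^ m)%N.
Proof. by elim: m => //= m IH; rewrite size_allpairs size_iota IH expnS. Qed.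

Lemma uniq_words N m : uniq (words N m).
Proof.
elim: m => //= m IH; apply: allpairs_uniq (iota_uniq 0 N) IH _.
by move=> [a b] [a' b'] _ _ /= [-> ->].
Qed.

(** A word is an exponent vector with entries below [N]; this evaluates its monomial at
    [x k, x k.+1, ...]. *)
Fixpoint word_prod x k (s : seq nat) : S :=
  if s is t :: s' then x k ^+ t * word_prod x k.+1 s' else 1.

Definition is_subalgebra A :=
  [/\ forall c : K, A c%:MP, forall f g, A f -> A g -> A (f + g) &
      forall f g, A f -> A g -> A (f * g)].

Lemma subalg_subalgebra (gens : S -> Prop) : is_subalgebra (subalg gens).
Proof.
by split=> *; [exact: subalg_const|exact: subalg_add|exact: subalg_mul].
Qed.

Section Closed.
Variable A : S -> Prop.
Hypothesis cA : is_subalgebra A.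

Lemma subalgebra_exp f n : A f -> A (f ^+ n).
Proof.
case: cA => Ac _ AM Af; elim: n => [|n IH]; first by rewrite expr0 -mpolyC1.
by rewrite exprS; apply: AM.
Qed.

Lemma subalgebra_sum (I : Type) (r : seq I) (Pr : pred I) (F : I -> S) :
  (forall i, Pr i -> A (F i)) -> A (\sum_(i <- r | Pr i) F i).
Proof.
case: cA => Ac AD _ AF; apply: big_ind => //.
by rewrite -mpolyC0.
Qed.

Lemma subalgebra_scale c f : A f -> A (c *: f).
Proof. by case: cA => Ac _ AM Af; rewrite -mul_mpolyC; apply: AM. Qed.

Lemma word_prod_subalgebra x k n N : (forall i, (k <= i < k + n)%N ->
  A (x i)) ->
  forall s, s \in words N n -> A (word_prod x k s).
Proof.
elim: n k => [|n IH] k Ax s /=.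
  by rewrite inE => /eqP->; rewrite /= -mpolyC1; case: cA.
case/allpairsP=> -[t s'] /= [_ s'W ->] /=.
have [_ _ AM] := cA; apply: AM.
  by apply: subalgebra_exp; apply: Ax;
    rewrite leqnn -[X in (X < _)%N]addn0 ltn_add2l.
apply: IH s'W => i /andP[ki ikn]; apply: Ax.
by rewrite (ltnW ki) addnS -addSn.
Qed.

(** Asking only that the relation hold modulo [P k] lets the induction pass to [P k.+1], which
    contains [x k], with one variable fewer. *)
Lemma prime_chain_independent m (P : nat -> S -> Prop) x N :
  (forall i, (i <= m)%N -> prime_ideal A (P i)) ->
  (forall i, (i < m)%N ->
    [/\ forall f, P i f -> P i.+1 f, P i.+1 (x i) & ~ P i (x i)]) ->
  forall n k (c : seq nat -> K), (k + n)%N = m ->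
    P k (\sum_(s <- words N n) c s *: word_prod x k s) ->
    {in words N n, forall s, c s = 0}.
Proof.
have [Ac AD AM] := cA.
move=> primeP chainP; elim=> [|n IH] k c.
  rewrite addn0 => -> /=; rewrite big_seq1 => Pc s; rewrite inE => /eqP->.
  apply/eqP/negP => /negP c0; have [_ _ _ PM [N1 _]] := primeP m (leqnn m).
  apply: N1; rewrite -(scale1r 1) -(mulVf c0) -scalerA -mul_mpolyC.
  exact: PM.
move=> km Pk; have ltkm : (k < m)%N by rewrite -km addnS ltnS leq_addr.
have [PkA Pk0 PkD PkM [Pk1 Pk_prime]] := primeP k (ltnW ltkm).
have [_ _ PD PM _] := primeP k.+1 ltkm.
have [PkS PSx Px] := chainP k ltkm.
have Ax i : (i < m)%N -> A (x i).
  move=> im; have [PA _ _ _ _] := primeP i.+1 im; apply: PA.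
  by case: (chainP i im).
(* [y t] is the coefficient of [x k ^+ t] when the relation is ordered by powers of [x k]. *)
pose y t := \sum_(s <- words N n) c (t :: s) *: word_prod x k.+1 s.
have Ay t : A (y t).
  rewrite /y big_seq; apply: subalgebra_sum => s sW; apply: subalgebra_scale.
  apply: word_prod_subalgebra sW => i /andP[_ ikn]; apply: Ax.
  by rewrite -km addnS -addSn.
have sumE : \sum_(s <- words N n.+1) c s *: word_prod x k s =
    \sum_(0 <= t < N) x k ^+ t * y t.
  rewrite /= big_allpairs_dep /index_iota subn0; apply: eq_bigr => t _.
  by rewrite mulr_sumr; apply: eq_bigr => s _; rewrite scalerAr.
have c0 t : (t < N)%N -> {in words N n, forall s, c (t :: s) = 0}.
  elim/ltn_ind: t => t IHt tN.
  have y0 u : (u < t)%N -> y u = 0.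
    move=> ut; rewrite /y big_seq big1 // => s sW.
    by rewrite (IHt u) ?scale0r // (ltn_trans ut).
  move: Pk; rewrite sumE (@big_cat_nat _ _ _ t) //=; last exact: ltnW.
  rewrite big_nat big1 ?add0r => [|u /andP[_ ut]]; last by rewrite y0 ?mulr0.
  rewrite big_ltn // => Pk.
  set z := \sum_(t.+1 <= u < N) x k ^+ (u - t.+1) * y u.
  have Az : A z.
    by apply: subalgebra_sum => u _; apply: AM => //; apply/subalgebra_exp/Ax.
  (* The common factor [x k ^+ t] is not in the prime [P k], so its cofactor is; modulo [P k.+1]
     only [y t] is left of that cofactor. *)
  have {}Pk : P k (x k ^+ t * (y t + x k * z)).
    move: Pk; rewrite mulrDr; congr (P k (_ + _)); rewrite /z 2!mulr_sumr.
    rewrite !big_nat; apply: eq_bigr => u /andP[tu _].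
    by rewrite !mulrA -exprSr -exprD subnKC.
  have Nxt u : ~ P k (x k ^+ u).
    elim: u => [|u IHu]; first exact: Pk1.
    by rewrite exprS => /Pk_prime[||//|//]; [exact: Ax|apply/subalgebra_exp/Ax].
  have Ayz : A (y t + x k * z) by apply: AD => //; apply: AM => //; exact: Ax.
  case: (Pk_prime _ _ _ Ayz Pk) => [|/Nxt//|/PkS Pyz].
    exact/subalgebra_exp/Ax.
  apply: (IH k.+1 (fun s => c (t :: s))); first by rewrite addSn -addnS.
  rewrite -/(y t) -[y t](addrK (x k * z)); apply: PD => //.
  by rewrite -mulN1r -mpolyC1 -mpolyCN [x k * z]mulrC !mulrA;
    apply: PM => //; apply: AM.
by move=> s /allpairsP[[t s'] /= [+ sW ->]]; rewrite mem_iota => tN; apply: c0.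
Qed.

End Closed.

(** * Counting monomials of bounded degree *)

Definition deg_le D (f : S) := {in msupp f, forall m, (mdeg m <= D)%N}.

Lemma deg_leM D1 D2 f g : deg_le D1 f -> deg_le D2 g ->
  deg_le (D1 + D2) (f * g).
Proof.
move=> fD gD m /msuppM_le/allpairsP[[m1 m2] /= [m1f m2g ->]].
by rewrite mdegD leq_add ?fD ?gD.
Qed.

Lemma deg_le1 : deg_le 0 1.
Proof. by move=> m; rewrite -mpolyC1 msupp1 inE => /eqP->; rewrite mdeg0. Qed.

Lemma deg_leX D f n : deg_le D f -> deg_le (n * D) (f ^+ n).
Proof.
move=> fD; elim: n => [|n IH]; first exact: deg_le1.
by rewrite exprS mulSn; apply: deg_leM.
Qed.

Lemma deg_leW D D' f : (D <= D')%N -> deg_le D f -> deg_le D' f.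
Proof. by move=> DD fD m /fD/leq_trans; apply. Qed.

Lemma deg_le_word_prod D N x k n : (forall i, (k <= i < k + n)%N ->
  deg_le D (x i)) ->
  {in words N n, forall s, deg_le (n * (N * D)) (word_prod x k s)}.
Proof.
elim: n k => [|n IH] k xD s /=.
  by rewrite inE => /eqP->; exact: deg_le1.
case/allpairsP=> -[t s'] /= [+ s'W ->] /=; rewrite mem_iota /= => tN.
rewrite mulSn; apply: deg_leM.
  apply: (@deg_leW (t * D)); first by rewrite leq_mul2r (ltnW tN) orbT.
  by apply: deg_leX; apply: xD; rewrite leqnn -[X in (X < _)%N]addn0 ltn_add2l.
apply: IH s'W => i /andP[ki ikn]; apply: xD.
by rewrite (ltnW ki) addnS -addSn.
Qed.

(** Exponents are at most the degree, so the restriction to [J] takes at most [B.+1 ^ #|J|]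
    values. *)
Lemma count_monomials B (Rel : pred 'X_{1..d}) (J : {set 'I_d}) :
  (forall m m', Rel m -> Rel m' -> {in J, m =1 m'} -> m = m') ->
  exists2 Q : seq 'X_{1..d}, (size Q <= B.+1 ^ #|J|)%N &
    forall m, Rel m -> (mdeg m <= B)%N -> m \in Q.
Proof.
move=> injJ; pose T : finType := {ffun 'I_d -> 'I_B.+1}.
pose mn (g : T) := [multinom (g i : nat) | i < d].
pose F : {set T} := [set g | Rel (mn g)].
exists [seq mn g | g <- enum F].
  rewrite size_map -cardE.
  (* Clearing the exponents outside [J] is injective on [F]. *)
  pose r (g : T) : T := [ffun i => if i \in J then g i else ord0].
  rewrite -(@card_in_imset _ _ r) => [|g g']; last first.
    rewrite !inE => Rg Rg' rg; apply/ffunP => i; apply: val_inj.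
    have : mn g = mn g'.
      apply: injJ => // j jJ; rewrite !mnmE.
      by move/ffunP: rg => /(_ j); rewrite !ffunE jJ => ->.
    by move/mnmP => /(_ i); rewrite !mnmE.
  have <- : #|pffun_on (ord0 : 'I_B.+1) (mem J) predT| = (B.+1 ^ #|J|)%N.
    by rewrite card_pffun_on card_ord.
  apply/subset_leq_card/subsetP => _ /imsetP[g _ ->].
  apply/pffun_onP; split=> //; apply/supportP => i iJ.
  by rewrite ffunE (negPf iJ).
move=> m Rm mB; pose g : T := [ffun i => inord (m i)].
have mE : m = mn g.
  apply/mnmP => i; rewrite mnmE ffunE inordK // ltnS (leq_trans _ mB) //.
  by rewrite mdegE (bigD1 i) //= leq_addr.
by apply/mapP; exists g => //; rewrite mem_enum inE -mE.
Qed.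

(* Otherwise [#|J|.+1] elements of [A] are algebraically independent, and for
   large [N] their [N ^ #|J|.+1] small monomials do not fit in the space, of
   dimension [O(N ^ #|J|)], of the elements of [A] of the relevant degree. *)
Lemma prime_chain_bound A (Rel : pred 'X_{1..d}) (J : {set 'I_d}) n :
  is_subalgebra A -> (forall f, A f -> {in msupp f, forall m, Rel m}) ->
  (forall m m', Rel m -> Rel m' -> {in J, m =1 m'} -> m = m') ->
  has_prime_chain A n -> (n <= #|J|)%N.
Proof.
move=> cA AR injJ [P [primeP chainP]]; rewrite leqNgt; apply/negP => ltJn.
set j := #|J| in ltJn.
have [f fP] : exists f : 'I_j.+1 -> S,
    forall i : 'I_j.+1, P i.+1 (f i) /\ ~ P i (f i).
  have := @fin_all_exists 'I_j.+1 (fun=> S) (fun i g => P i.+1 g /\ ~ P i g).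
  apply => i.
  by have [_ [g gP gN]] := chainP i (leq_trans (ltn_ord i) ltJn); exists g.
pose x k := if insub k is Some i then f i else 0.
have xE (i : 'I_j.+1) : x i = f i by rewrite /x valK.
pose D := \max_(i < j.+1) msize (f i).
have xD i : (0 <= i < 0 + j.+1)%N -> deg_le D (x i).
  rewrite add0n /= => ij m; rewrite (xE (Ordinal ij)) => /msize_mdeg_lt/ltnW.
  by move=> le_m; apply: leq_trans le_m _; apply: leq_bigmax.
(* [N] is chosen so that [B.+1 ^ j <= N ^ j * (1 + j.+1 * D) ^ j < N ^ j.+1]: there are more words
   than available monomials. *)
pose N := ((1 + j.+1 * D) ^ j).+1.
pose B := (j.+1 * (N * D))%N.
have [Q szQ inQ] := count_monomials B injJ.
pose W := words N j.+1.
have Ax i : (0 <= i < 0 + j.+1)%N -> A (x i).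
  rewrite add0n /= => ij; rewrite (xE (Ordinal ij)).
  have [PA _ _ _ _] := primeP i.+1 (leq_trans ij ltJn).
  by apply: PA; case: (fP (Ordinal ij)).
have [||u u0 sum0] := @mpoly_dependent (size W)
    (fun i => word_prod x 0 (nth [::] W i)) Q.
- move=> i m mi; have iW : nth [::] W i \in W by rewrite mem_nth.
  apply: inQ; first by apply: AR mi; apply: word_prod_subalgebra iW.
  exact: (deg_le_word_prod xD iW).
- rewrite size_words (leq_ltn_trans szQ) // -/j.
  apply: (@leq_ltn_trans ((N * (1 + j.+1 * D)) ^ j)).
    have leX a b : (a <= b -> a ^ j <= b ^ j)%N.
      by case: (j) => // j' ab; rewrite leq_exp2r.
    by apply: leX; rewrite mulnDr muln1 /B -add1n leq_add // mulnCA.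
  by rewrite expnMn expnSr ltn_pmul2l ?expn_gt0 // /N ltnS.
pose c s := if insub (index s W) is Some i then u 0 i else 0.
have chainx i : (i < j.+1)%N ->
    [/\ forall g, P i g -> P i.+1 g, P i.+1 (x i) & ~ P i (x i)].
  move=> ij; have [sP _] := chainP i (leq_trans ij ltJn).
  by rewrite (xE (Ordinal ij)); have [] := fP (Ordinal ij).
have primej i : (i <= j.+1)%N -> prime_ideal A (P i).
  by move=> ij; apply: primeP; exact: leq_trans ij ltJn.
have c0 : {in W, forall s, c s = 0}.
  apply: (prime_chain_independent cA primej chainx (add0n _)).
  have [_ P0 _ _ _] := primeP 0%N (leq0n n).
  rewrite (_ : \sum_(s <- _) _ = 0) // -[RHS]sum0 (big_nth [::]) big_mkord.
  apply: eq_bigr => i _; congr (_ *: _).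
  by rewrite /c index_uniq ?uniq_words // valK.
case/negP: u0; apply/eqP/rowP => i; rewrite mxE.
have := c0 _ (mem_nth [::] (ltn_ord i)).
by rewrite /c index_uniq ?uniq_words // valK.
Qed.

End KrullBound.

(** * Dimension of edge rings *)

Section MonomialPrimes.
Variables (K : fieldType) (d : nat).
Local Notation S := {mpoly K[d]}.

(** Substitution of [0] for the variables in [Z]; its kernel is the ideal they generate, which
    yields the primes of the chain. *)
Definition vanish_on (Z : {set 'I_d}) : d.-tuple S :=
  [tuple if i \in Z then 0 else 'X_i | i < d].

Lemma comp_vanish_on (Z : {set 'I_d}) (m : 'X_{1..d}) :
  'X_[m] \mPo vanish_on Z =
  if [exists i in Z, m i != 0%N] then 0 else 'X_[m] :> S.
Proof.
rewrite comp_mpolyX; case: ifPn => [/existsP[i /andP[iZ mi]]|].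
  rewrite (bigD1 i) //= tnth_mktuple iZ.
  by case: (m i) mi => // n _; rewrite exprS !mul0r.
rewrite negb_exists => /forallP mZ; rewrite mpolyXE_id.
apply: eq_bigr => i _; rewrite tnth_mktuple.
have := mZ i; rewrite negb_and negbK; case: (i \in Z) => //= /eqP->.
by rewrite !expr0.
Qed.

Lemma comp_vanish_onS (Z Z' : {set 'I_d}) (f : S) : Z \subset Z' ->
  (f \mPo vanish_on Z) \mPo vanish_on Z' = f \mPo vanish_on Z'.
Proof.
move=> /subsetP sZ; rewrite !(comp_mpolyEX f) raddf_sum /=.
apply: eq_bigr => m _; rewrite !comp_mpolyZ !comp_vanish_on.
case: ifP => [/existsP[i /andP[iZ mi]]|_]; last by rewrite comp_vanish_on.
by rewrite comp_mpoly0 ifT //; apply/existsP; exists i; rewrite sZ.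
Qed.

Lemma prime_ideal_vanish_on (A : S -> Prop) Z : is_subalgebra A ->
  prime_ideal A (fun f => A f /\ f \mPo vanish_on Z = 0).
Proof.
move=> [Ac AD AM]; split.
- by move=> f [].
- by split; [rewrite -mpolyC0|rewrite comp_mpoly0].
- by move=> f g [Af f0] [Ag g0]; split;
  [exact: AD|rewrite comp_mpolyD f0 g0 addr0].
- by move=> a f Aa [Af f0]; split; [exact: AM|rewrite rmorphM /= f0 mulr0].
split; first by rewrite comp_mpoly1 => -[_ /eqP]; rewrite oner_eq0.
move=> f g Af Ag [_]; rewrite rmorphM /= => /eqP; rewrite mulf_eq0.
by case/orP => /eqP ?; [left|right].
Qed.

End MonomialPrimes.

(** * Bounds for the dimension of the edge ring *)

Section EdgeRingDimension.
Variables (K : fieldType) (d : nat) (E : {set {set 'I_d}}) (L : {set 'I_d}).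
Hypothesis simpleE : simple_graph E.
Local Notation S := {mpoly K[d]}.
Local Notation A := (@edge_ring K d E L).

(** A vertex outside [L] has a neighbour after it, so vertices can be removed from the front while
    each still has a generator using only itself and later ones. *)
Fixpoint elimination_order (s : seq 'I_d) : bool :=
  if s is v :: t then
    ((v \in L) || has (adj E v) t) && elimination_order t
  else true.

(** The list grows at its front. If no vertex could be added, the list would be a union of
    components containing [L], hence all of the vertices. *)
Lemma elimination_orderP : meets_every_component E L ->
  exists s, [/\ uniq s, size s = d & elimination_order s].
Proof.
move=> meetL; suff: forall n, (n <= d)%N ->
    exists s, [/\ uniq s, size s = n & elimination_order s] by apply.
elim=> [|n IH] nd; first by exists [::].
have [s [us szs os]] := IH (ltnW nd).
have [v vs gv] : exists2 v, v \notin s & (v \in L) || has (adj E v) s.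
  have [/existsP[v /andP[? ?]]|] := boolP [exists v, (v \notin s) &&
      ((v \in L) || has (adj E v) s)]; first by exists v.
  rewrite negb_exists => /forallP stuck; exfalso.
  have closed_s : closed (adj E) (mem s).
    apply: (intro_closed (connect_adjC E)) => i k aik /= si.
    have := stuck k; rewrite negb_and negbK => /orP[//|].
    by rewrite negb_or => /andP[_ /hasPn/(_ i si)]; rewrite adj_sym aik.
  have all_s i : i \in s.
    have [|v vL] := meetL [set j | connect (adj E) i j].
      by apply/imsetP; exists i.
    rewrite inE => iv; rewrite (closed_connect closed_s iv).
    by have := stuck v; rewrite vL andbT negbK.
  have : (#|'I_d| <= size s)%N.
    by rewrite -(card_uniqP us); apply/subset_leq_card/subsetP.
  by rewrite card_ord szs leqNgt nd.
by exists (v :: s); rewrite /= vs us szs gv os.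
Qed.

Lemma edge_ring_subalgebra : is_subalgebra A.
Proof. exact: subalg_subalgebra. Qed.

(* [P_k = A :&: (x_v : v among the first k vertices)]; the order guarantees that
   the [k]-th vertex has a generator of [A] avoiding all the previous ones. *)
Lemma edge_ring_prime_chain : meets_every_component E L -> has_prime_chain A d.
Proof.
move=> /elimination_orderP[s [us szs os]].
pose Z k : {set 'I_d} := [set v | v \in take k s].
exists (fun k f => A f /\ f \mPo vanish_on K (Z k) = 0); split.
  by move=> k _; apply/prime_ideal_vanish_on/edge_ring_subalgebra.
move=> k kd; have ks : (k < size s)%N by rewrite szs.
have sZ : Z k \subset Z k.+1.
  apply/subsetP => v; rewrite !inE => vk.
  by rewrite (take_nth v ks) mem_rcons inE vk orbT.
split=> [f [Af f0]|].
  by split=> //; rewrite -(comp_vanish_onS _ sZ) f0 comp_mpoly0.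
pose v := nth (Ordinal kd) s k.
have sE : s = take k s ++ v :: drop k.+1 s.
  by rewrite -drop_nth // cat_take_drop.
have vZ : v \in Z k.+1 by rewrite inE (take_nth (Ordinal kd)) //
  mem_rcons inE eqxx.
have Zk u : u \in v :: drop k.+1 s -> u \notin Z k.
  move=> us'; rewrite inE; move: us; rewrite [X in uniq X]sE cat_uniq.
  by case/and3P => _ /hasPn/(_ u us') /= ukn _.
(* It suffices to find a monomial of [A] that involves [v] but no earlier vertex: [x_v^2], or
   [x_v x_w] with [w] later in the order. *)
suff [m Am [mv mZ]] : exists2 m, A 'X_[m] &
    m v != 0%N /\ (forall u, u \in Z k -> m u = 0%N).
  exists 'X_[m].
    split=> //; rewrite comp_vanish_on ifT //; apply/existsP; exists v.
    by rewrite vZ.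
  move=> [_]; rewrite comp_vanish_on ifF => [/eqP|].
    by rewrite -msupp_eq0 msuppX.
  by apply/existsP => -[u /andP[/mZ->]]; rewrite eqxx.
have : elimination_order (v :: drop k.+1 s).
  have : elimination_order (take k s ++ v :: drop k.+1 s) by rewrite -sE.
  by elim: (take k s) => //= a t IH /andP[_].
move=> /= /andP[+ _] => /orP[vL|/hasP[w ws vw]].
  exists (U_(v) *+ 2)%MM.
    by rewrite -mpolyXn; apply: subalg_gen; right; exists v.
  split=> [|u uZ]; rewrite mulmnE mnm1E ?eqxx //.
  by case: eqP uZ => // <-; rewrite (negPf (Zk _ _)) // mem_head.
exists (mesym1 [set v; w]).
  by apply: subalg_gen; left; exists [set v; w].
split=> [|u uZ]; rewrite mnmE !inE ?eqxx //.
case: eqP uZ => [->|_]; first by rewrite (negPf (Zk _ _)) // mem_head.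
by case: eqP => [->|//]; rewrite (negPf (Zk _ _)) // inE ws orbT.
Qed.

Lemma edge_ring_chain_le n : has_prime_chain A n -> (n <= d)%N.
Proof.
move=> chn; rewrite -[d]card_ord -cardsT.
apply: (prime_chain_bound edge_ring_subalgebra (Rel := predT)) chn => //.
by move=> m m' _ _ mm'; apply/mnmP => i; apply: mm'; rewrite inE.
Qed.

(** * Components avoiding [L] *)

Variable c : 'I_d -> bool.
Hypothesis bipE : forall i j, adj E i j -> c i != c j.

Definition balanced (C : {set 'I_d}) (m : 'X_{1..d}) : bool :=
  \sum_(i in C | c i) m i == \sum_(i in C | ~~ c i) m i.

Lemma balancedD C m1 m2 : balanced C m1 -> balanced C m2 ->
  balanced C (m1 + m2)%MM.
Proof.
rewrite /balanced => /eqP b1 /eqP b2.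
rewrite (eq_bigr (fun i => m1 i + m2 i)%N) => [|i _]; last exact: mnmDE.
rewrite [X in _ == X](eq_bigr (fun i => m1 i + m2 i)%N) => [|i _];
  last exact: mnmDE.
by rewrite !big_split /= b1 b2.
Qed.

(** An edge inside [C] has one end in each colour class; all other edges and the loops miss [C]. *)
Lemma edge_ring_balanced C : C \in components E -> [disjoint C & L] ->
  forall f, A f -> {in msupp f, forall m, balanced C m}.
Proof.
move=> CE CL f; rewrite /edge_ring.
elim=> {f} [f gf|k|f g _ IHf _ IHg|f g _ IHf _ IHg] m.
- case: gf => [[e eE ->]|[i iL ->]]; rewrite ?mpolyXn msuppX inE => /eqP->.
    have [i [j [ij eij]]] := simple_edgeP simpleE eE.
    have aij : adj E i j by rewrite /adj /= -eij.
    have Cij : (i \in C) = (j \in C).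
      case/imsetP: CE => k _ ->; rewrite !inE.
      exact: (same_connect_r (connect_adjC E) (connect1 aij)).
    have sumE (P : pred 'I_d) : (\sum_(k in C | P k) mesym1 e k =
        (i \in C) * (P i + P j))%N.
      rewrite big_mkcondl big_mkcond /=.
      rewrite (bigD1 i) //= (bigD1 j) 1?eq_sym //= big1 => [|k /andP[ki kj]].
        rewrite !mnmE eij !inE !eqxx orbT -Cij.
        by case: (P i); case: (P j); case: (i \in C).
      by rewrite mnmE eij !inE (negPf ki) (negPf kj); case: (P k); case: (k \in C).
    rewrite /balanced !sumE; have := bipE aij.
    by case: (c i); case: (c j).
  have iC : i \notin C by rewrite (disjointFl CL).
  rewrite /balanced !big1 // => k /andP[kC _]; rewrite mulmnE mnm1E;
  by case: eqP kC iC => // -> ->.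
- rewrite msuppC; case: eqP => //= _; rewrite inE => /eqP->.
  by rewrite /balanced !big1 // => i _; rewrite mnm0E.
- by move/msuppD_le; rewrite mem_cat => /orP[/IHf|/IHg].
- by move/msuppM_le/allpairsP => [[m1 m2] /= [/IHf b1 /IHg b2 ->]];
  apply: balancedD.
Qed.

(** A balanced monomial is determined by its exponents away from one vertex [i0] of [C], so at most
    [d - 1] exponents are free. *)
Lemma edge_ring_chain_lt n : ~ meets_every_component E L ->
  has_prime_chain A n -> (n < d)%N.
Proof.
move=> Nmeet chn.
have [C CE CL] : exists2 C, C \in components E & [disjoint C & L].
  have [/existsP[C /andP[? ?]]|] :=
    boolP [exists C, (C \in components E) && [disjoint C & L]].
    by exists C.
  rewrite negb_exists => /forallP no; case: Nmeet => C CE.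
  have := no C; rewrite CE /= -setI_eq0 => /set0Pn[i].
  by rewrite inE => /andP[iC iL]; exists i.
have [i0 i0C] : exists i, i \in C.
  by case/imsetP: CE => i _ ->; exists i; rewrite inE connect0.
have d0 : (0 < d)%N by apply: leq_ltn_trans (ltn_ord i0).
suff : (n <= #|[set~ i0]|)%N by rewrite cardsC1 card_ord; case: (d) d0.
apply: prime_chain_bound edge_ring_subalgebra (edge_ring_balanced CE CL) _ chn.
move=> m m' /eqP bm /eqP bm' mm'; apply/mnmP => i.
have [->{i}|ii0] := eqVneq i i0; last by apply: mm'; rewrite !inE.
have others (P : pred 'I_d) : ~~ P i0 ->
    \sum_(i in C | P i) m i = \sum_(i in C | P i) m' i.
  move=> Pi0; apply: eq_bigr => i /andP[_ Pi]; apply: mm'; rewrite !inE.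
  by apply: contraNneq Pi0 => <-.
have this (P : pred 'I_d) : P i0 ->
    \sum_(i in C | P i) m i = \sum_(i in C | P i) m' i -> m i0 = m' i0.
  move=> Pi0; rewrite (bigD1 i0) ?i0C //= [RHS](bigD1 i0) ?i0C //=.
  rewrite (eq_bigr m') => [/addIn //|i /andP[_ ii0]].
  by apply: mm'; rewrite !inE.
(* Balance equates the sum over the class of [i0] with that over the other class, on which [m] and
   [m'] agree. *)
have [ci|ci] := boolP (c i0).
  by apply: (this c) => //; rewrite bm bm' others // negbK.
by apply: (this (fun i => ~~ c i)) => //; rewrite -bm -bm' others.
Qed.

Lemma edge_ring_dim : has_krull_dim A d <-> meets_every_component E L.
Proof.
split=> [[chd _]|meetL]; last first.
  by split; [exact: edge_ring_prime_chain|exact: edge_ring_chain_le].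
(* Deciding the condition makes contraposition available. *)
have meetP : reflect (meets_every_component E L)
    [forall C in components E, [exists i in L, i \in C]].
  apply: (iffP forall_inP) => H C CE.
    by have /existsP[i /andP[iL iC]] := H C CE; exists i.
  by apply/existsP; have [i iL iC] := H C CE; exists i; rewrite iL.
by apply/meetP/negPn/negP => /meetP/edge_ring_chain_lt/(_ chd); rewrite ltnn.
Qed.

End EdgeRingDimension.

(** * Jacobian minors and Gauss algebras *)

Section MaximalMinors.

(** Cauchy-Binet before collecting terms: the sum runs over all row choices, in any order and with
    repetition. *)
Lemma det_mulmx_expand (R : comNzRingType) n d (B : 'M[R]_(d, n)) (J :
  'M_(n, d)) :
  \det (B *m J) =
  \sum_(phi : {ffun 'I_d -> 'I_n}) (\prod_i B i (phi i)) * \det (rowsub phi J).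
Proof.
transitivity (\sum_(s : 'S_d) \sum_(phi : {ffun 'I_d -> 'I_n})
    (\prod_i B i (phi i)) * ((-1) ^+ s * \prod_i rowsub phi J i (s i))).
  apply: eq_bigr => s _.
  rewrite (eq_bigr (fun i => \sum_j B i j * J j (s i))) => [|i _];
    last by rewrite mxE.
  rewrite bigA_distr_bigA mulr_sumr; apply: eq_bigr => phi _.
  rewrite big_split /= mulrCA; congr (_ * (_ * _)).
  by apply: eq_bigr => i _; rewrite mxE.
by rewrite exchange_big; apply: eq_bigr => phi _; rewrite mulr_sumr.
Qed.

(** [rows] lists the image of [phi] increasingly and [s] gives the rank of each value; this matches
    the increasing rows of [jacobian_minor]. *)
Lemma sort_injection d n (phi : 'I_d -> 'I_n) : injective phi ->
  exists rows : 'I_d -> 'I_n, exists s : 'S_d,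
    (forall i j : 'I_d, (i < j)%N -> (rows i < rows j)%N) /\
    forall i, phi i = rows (s i).
Proof.
move=> injphi; pose A := [set phi i | i : 'I_d].
have cA : d = #|A| by rewrite card_imset // card_ord.
pose rows (i : 'I_d) : 'I_n := enum_val (cast_ord cA i).
have phiA i : phi i \in A by apply: imset_f.
pose f i : 'I_d := cast_ord (esym cA) (enum_rank_in (phiA i) (phi i)).
have fE i : rows (f i) = phi i by rewrite /rows /f cast_ordKV enum_rankK_in.
have injf : injective f by move=> i j fij; apply: injphi; rewrite -!fE fij.
exists rows, (perm injf); split=> [i j ij|i]; last by rewrite permE fE.
have srt : sorted (relpre (@nat_of_ord n) ltn) (enum A).
  rewrite {1}/enum_mem -enumT /=; apply: sorted_filter.
    by move=> a b c; apply: ltn_trans.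
  by rewrite -sorted_map val_enum_ord iota_ltn_sorted.
rewrite /rows !(enum_val_nth (phi i)) /=.
have tr : transitive (relpre (@nat_of_ord n) ltn) by move=> a b c;
  apply: ltn_trans.
by apply: (sorted_ltn_nth tr (phi i) srt); rewrite ?inE -?cardE -?cA.
Qed.

End MaximalMinors.

Section Gauss.
Variables (K : fieldType) (d : nat).
Local Notation S := {mpoly K[d]}.

Lemma subalg_min (gens A : S -> Prop) : is_subalgebra A ->
  (forall f, gens f -> A f) -> forall f, subalg gens f -> A f.
Proof.
by move=> [Ac AD AM] gA f; elim=> // {}f g _ Af _ Ag; [exact: AD|exact: AM].
Qed.

Lemma subalg_mono (gens gens' : S -> Prop) :
  (forall f, gens f -> subalg gens' f) ->
  forall f, subalg gens f -> subalg gens' f.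
Proof. exact: subalg_min (subalg_subalgebra _). Qed.

(** A repeated row gives [0]; otherwise sorting the rows changes only the sign. *)
Lemma minor_subalg n (g : n.-tuple S) (phi : 'I_d -> 'I_n) :
  subalg (jacobian_minor g) (\det (rowsub phi (jacobian g))).
Proof.
have [/injectiveP injphi|/injectivePn[i [j ij pij]]] := boolP (injectiveb phi).
  have [rows [s [inc_rows phiE]]] := sort_injection injphi.
  have -> : rowsub phi (jacobian g) = row_perm s (rowsub rows (jacobian g)).
    by apply/matrixP => i j; rewrite !mxE phiE.
  rewrite row_permE det_mulmx det_perm; apply: subalg_mul.
    rewrite -mpolyC1 -mpolyCN -rmorphXn; exact: subalg_const.
  by apply: subalg_gen; exists rows.
rewrite (determinant_alternate ij) => [|k]; last by rewrite !mxE pij.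
by rewrite -mpolyC0; apply: subalg_const.
Qed.

(** The Jacobian matrix of [g] is a constant matrix times that of [h], so its minors are
    [K]-combinations of those of [h]. *)
Lemma minors_subalg n n' (g : n.-tuple S) (h : n'.-tuple S) :
  (forall i, exists c : 'I_n' -> K, tnth g i = \sum_j c j *: tnth h j) ->
  forall f, subalg (jacobian_minor g) f -> subalg (jacobian_minor h) f.
Proof.
move=> gh; apply: subalg_mono => _ [rows [_ ->]].
have := @fin_all_exists 'I_n (fun=> 'I_n' -> K)
  (fun i c => tnth g i = \sum_j c j *: tnth h j) gh.
move=> [C gE].
have -> : rowsub rows (jacobian g) =
    (\matrix_(i, j) (C (rows i) j)%:MP) *m jacobian h.
  apply/matrixP => i j; rewrite !mxE gE linear_sum; apply: eq_bigr => k _.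
  by rewrite linearZ /= !mxE mul_mpolyC.
rewrite det_mulmx_expand;
  apply: (subalgebra_sum (subalg_subalgebra _)) => phi _.
apply: subalg_mul; last exact: minor_subalg.
rewrite (eq_bigr (fun i => (C (rows i) (phi i))%:MP)) => [|i _];
  last by rewrite mxE.
by rewrite -rmorph_prod; apply: subalg_const.
Qed.

(** * Comparing presentations by forms of equal degree *)

Definition low_free k (f : S) :=
  forall m, (0 < mdeg m < k)%N -> f@_m = 0.

(** Without their constant terms both factors start in degree at least [k], so their product starts
    in degree at least [2k] and only the cross terms remain. *)
Lemma mcoeffM_low_free k f g m : (0 < k)%N -> low_free k f -> low_free k g ->
  (0 < mdeg m <= k)%N -> (f * g)@_m = f@_0%MM * g@_m + g@_0%MM * f@_m.
Proof.
move=> k0 lf lg /andP[m0 mk].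
have splitP (p : S) : low_free k p -> exists2 q : S,
    p = (p@_0%MM)%:MP + q & {in msupp q, forall m, (k <= mdeg m)%N}.
  move=> lp; exists (p - (p@_0%MM)%:MP); first by rewrite addrC subrK.
  move=> l; rewrite mcoeff_msupp mcoeffB mcoeffC; apply: contraR;
    rewrite -ltnNge => lk.
  have [->|l0] := eqVneq l 0%MM; first by rewrite mulr1 subrr.
  by rewrite mulr0 subr0 lp // lk lt0n mdeg_eq0 l0.
have [f' fE f'k] := splitP f lf; have [g' gE g'k] := splitP g lg.
have mn0 : (m == 0%MM) = false by rewrite -mdeg_eq0 -[X in X = _]negbK -lt0n m0.
have -> : f@_m = f'@_m by rewrite {1}fE mcoeffD mcoeffC mn0 mulr0 add0r.
have -> : g@_m = g'@_m by rewrite {1}gE mcoeffD mcoeffC mn0 mulr0 add0r.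
have fg0 : (f' * g')@_m = 0.
  apply: memN_msupp_eq0;
    apply/negP => /msuppM_le/allpairsP[[m1 m2] /= [m1f m2g mE]].
  have := leq_add (f'k _ m1f) (g'k _ m2g);
    rewrite -mdegD -mE => /leq_trans/(_ mk).
  by rewrite -[X in (_ <= X)%N]addn0 leq_add2l leqNgt k0.
rewrite {1}fE {1}gE mulrDl !mulrDr !mcoeffD fg0 addr0 !mcoeffCM.
by rewrite [f' * _]mulrC mcoeffCM mcoeffC mn0 !mulr0 add0r addrC.
Qed.

(* Modulo degree greater than [k], a product of polynomials without terms of
   degree [1, ..., k - 1] is a linear combination of its two factors and [1]. *)
Lemma linear_part k n (s : n.-tuple S) : (0 < k)%N ->
  (forall f, f \in s -> low_free k f) ->
  forall f, subalg (fun f => f \in s) f ->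
    low_free k f /\ exists c : 'I_n -> K,
      forall m, mdeg m = k -> f@_m = \sum_i c i * (tnth s i)@_m.
Proof.
move=> k0 sk f.
elim=> {f} [f fs|c|f g _ [lf [a fE]] _ [lg [b gE]]
  |f g _ [lf [a fE]] _ [lg [b gE]]].
- split; first exact: sk.
  have /tnthP[i fi] := fs; exists (fun j => (j == i)%:R) => m mk.
  rewrite (bigD1 i) //= big1 => [|j /negPf->]; last by rewrite mul0r.
  by rewrite eqxx mul1r addr0 fi.
- have C0 m : (0 < mdeg m)%N -> (c%:MP : S)@_m = 0.
    by rewrite mcoeffC -mdeg_eq0; case: eqP => [->//|_ _]; rewrite mulr0.
  split=> [m /andP[m0 _]|]; first exact: C0.
  by exists (fun=> 0) => m mk; rewrite C0 ?mk // big1 // => i _; rewrite mul0r.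
- split=> [m mk|]; first by rewrite mcoeffD lf ?lg ?addr0.
  exists (fun i => a i + b i) => m mk; rewrite mcoeffD fE // gE // -big_split.
  by apply: eq_bigr => i _; rewrite mulrDl.
split=> [m mk|].
  rewrite (mcoeffM_low_free k0 lf lg) ?(lf m) ?(lg m) ?mulr0 ?addr0 //.
  by case/andP: mk => m0 /ltnW mk; apply/andP.
exists (fun i => f@_0%MM * b i + g@_0%MM * a i) => m mk.
rewrite (mcoeffM_low_free k0 lf lg) ?mk ?k0 ?leqnn // (fE m) // (gE m) //.
rewrite !mulr_sumr -big_split; apply: eq_bigr => i _.
by rewrite mulrDl !mulrA.
Qed.

Lemma homog_low_free k (f : S) : f \is k.-homog -> low_free k f.
Proof.
move=> /dhomog_nemf_coeff hf m /andP[_ mk]; apply: hf.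
by rewrite neq_ltn mk.
Qed.

Lemma homog_linear_part k n (s : n.-tuple S) f : (0 < k)%N ->
  (forall i, tnth s i \is k.-homog) -> f \is k.-homog ->
  subalg (fun f => f \in s) f -> exists c : 'I_n -> K,
    f = \sum_i c i *: tnth s i.
Proof.
move=> k0 sk fk /(linear_part k0) [g /tnthP[i ->]|_ [c fE]].
  exact/homog_low_free/sk.
exists c; apply/mpolyP => m; rewrite raddf_sum /=.
under eq_bigr do rewrite mcoeffZ.
have [/fE//|mk] := eqVneq (mdeg m) k.
rewrite (dhomog_nemf_coeff fk) // big1 // => i _.
by rewrite (dhomog_nemf_coeff (sk i)) ?mulr0.
Qed.

(** In degree [k], the form [f] agrees with a linear combination of members of [g], which have no
    such terms if [k'] differs from [k]. *)
Lemma homog_presentation n n' k k' (g : n.-tuple S) (h : n'.-tuple S) f :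
  (0 < k)%N -> (forall i, tnth h i \is k.-homog) ->
  (forall i, tnth g i \is k'.-homog) ->
  (forall f, subalg (fun f => f \in g) f <-> subalg (fun f => f \in h) f) ->
  f \is k.-homog -> f != 0 -> subalg (fun f => f \in h) f -> k' = k.
Proof.
move=> k0 hk gk' gh fk f0 fh.
have hlow p : subalg (fun f => f \in h) p -> low_free k p.
  move=> /(linear_part k0) [q /tnthP[i ->]|//].
  exact/homog_low_free/hk.
have glow p : p \in g -> low_free k p.
  by move=> pg; apply/hlow/gh/subalg_gen.
have [_ [c fE]] := linear_part k0 glow ((gh f).2 fh).
apply/eqP; apply: contraR f0 => kk'; apply/eqP/mpolyP => m; rewrite mcoeff0.
have [mk|mk] := eqVneq (mdeg m) k; last by rewrite (dhomog_nemf_coeff fk).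
rewrite fE // big1 // => i _.
by rewrite (dhomog_nemf_coeff (gk' i)) ?mulr0 //= mk eq_sym.
Qed.

(** * Minors of monomial Jacobians *)

Local Notation Ix := ({set 'I_d} + 'I_d)%type.

(** Multiplying column [j] by [x_j] turns the entry [a_ij x^(a_i) / x_j] into [a_ij x^(a_i)], and
    the monomials then factor out of the rows. *)
Lemma det_jacobian_monomials n (a : 'I_n -> Ix) (phi : 'I_d -> 'I_n) :
  \det (rowsub phi (jacobian [tuple 'X_[gen_exp (a i)] | i < n]))
    * 'X_[mesym1 setT] =
  \prod_i 'X_[gen_exp (a (phi i))] * (\det (exp_matrix K (a \o phi)))%:MP :> S.
Proof.
set J := rowsub _ _.
have -> : 'X_[mesym1 setT] = \det (diag_mx (\row_i 'X_i)) :> S.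
  rewrite det_diag mesym1_setT -mprodXE.
  by apply: eq_bigr => i _; rewrite mxE.
have -> : \prod_i 'X_[gen_exp (a (phi i))] =
    \det (diag_mx (\row_i ('X_[gen_exp (a (phi i))] : S))).
  by rewrite det_diag; apply: eq_bigr => i _; rewrite mxE.
rewrite -det_map_mx -!det_mulmx; congr (\det _ ); apply/matrixP => i j.
rewrite mul_mx_diag mul_diag_mx !mxE tnth_mktuple mderivX [RHS]mulrC mul_mpolyC.
set m := gen_exp _; rewrite -scalerAl -mpolyXD.
(* For a zero exponent the coefficient vanishes, so the truncated subtraction does no harm. *)
have [->|mj] := eqVneq (m j) 0%N; first by rewrite !scale0r.
by rewrite submK // lep1mP.
Qed.

Hypothesis charK : [pchar K] =i pred0.

Let two_neq0 : 2%:R != 0 :> K.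
Proof. by rewrite (pcharf0P K).1. Qed.

(** * The Gauss algebra of the edge ring *)

Section EdgeRing.
Variables (E : {set {set 'I_d}}) (L : {set 'I_d}) (c : 'I_d -> bool).
Hypothesis simpleE : simple_graph E.
Hypothesis bipE : forall i j, adj E i j -> c i != c j.
Hypothesis L_neq0 : L != set0.
Local Notation A := (@edge_ring K d E L).
Implicit Types (V : {set 'I_d}) (T : {set {set 'I_d}}).

(** Multiplying [x_V e_T / x_{V^c}] by [x_V x_{V^c}] gives [x_V^2 e_T]. *)
Lemma gmon_gen_set V T : admissible E L V T ->
  gmon K V T * 'X_[mesym1 setT] = \prod_(x in gen_set V T) 'X_[gen_exp x].
Proof.
move=> adm; have -> : mesym1 setT = (mesym1 (~: V) + mesym1 V)%MM :> 'X_{1..d}.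
  by apply/mnmP => i; rewrite mnmDE !mnmE !inE; case: (i \in V).
rewrite mpolyXD mulrA (gmonE K adm) big_gen_set /= mulrC mulrA [RHS]mulrC.
congr (_ * _); rewrite !mprodXE -mpolyXD; congr 'X_[_].
apply/mnmP => i; rewrite mnm_sumE mnmDE !mnmE.
rewrite (eq_bigr (fun j => if j == i then 2 else 0)%N) => [|j _]; last first.
  by rewrite mulmnE mnm1E; case: eqP.
rewrite -big_mkcondr /=; case: (boolP (i \in V)) => iV.
  by rewrite (big_pred1 i) // => j /=; case: eqVneq => [->|_];
    rewrite ?iV ?andbF.
by rewrite big1 // => j /andP[jV /eqP ji]; rewrite -ji jV in iV.
Qed.

Lemma admissible_rooted V T : admissible E L V T -> spanning_forest_rooted T V.
Proof. by case. Qed.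

Lemma simple_sub (T : {set {set 'I_d}}) : T \subset E -> simple_graph T.
Proof. by move=> /subsetP sT e /sT/simpleE. Qed.

Lemma bip_sub (T : {set {set 'I_d}}) : T \subset E ->
  forall i j, adj T i j -> c i != c j.
Proof. by move=> /subsetP sT i j /sT/bipE. Qed.

Lemma card_admissible V T : admissible E L V T -> #|gen_set V T| = d.
Proof.
move=> adm; have [_ _ TE _ _] := adm.
exact: (card_rooted_forest (simple_sub TE) (bip_sub TE) two_neq0
  (admissible_rooted adm)).
Qed.

Let X := gen_set L E.

Definition edge_gens : #|X|.-tuple S :=
  [tuple 'X_[gen_exp (enum_val i)] | i < #|X|].

Lemma edge_gensP (f : S) : reflect (exists2 x, x \in X & f = 'X_[gen_exp x])
  (f \in edge_gens).
Proof.
apply: (iffP (tnthP edge_gens f)) => [[i ->]|[x xX ->]].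
  by exists (enum_val i); rewrite ?enum_valP ?tnth_mktuple.
by exists (enum_rank_in xX x); rewrite tnth_mktuple enum_rankK_in.
Qed.

Lemma edge_gens_generate : generates (fun f => f \in edge_gens) A.
Proof.
move=> f; split; apply: subalg_mono => {}f.
  case/edge_gensP => -[e|i]; rewrite inE => xX ->; apply: subalg_gen.
    by left; exists e.
  by right; exists i => //; rewrite mpolyXn.
case=> [[e eE ->]|[i iL ->]]; apply/subalg_gen/edge_gensP.
  by exists (inl e); rewrite ?inE.
by exists (inr i); rewrite ?inE ?mpolyXn.
Qed.

Lemma edge_gens_homog i : tnth edge_gens i \is 2.-homog.
Proof.
rewrite tnth_mktuple dhomogX; have := enum_valP i.
case: (enum_val i) => [e|j]; rewrite inE /= => xX.
  by rewrite mdeg_mesym1 simpleE.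
by rewrite mdegMn mdeg1.
Qed.

Lemma mpolyX_neq0 (m : 'X_{1..d}) : 'X_[m] != 0 :> S.
Proof. by rewrite -msupp_eq0 msuppX. Qed.

(** A nonsingular exponent matrix makes the chosen edges and loops a rooted forest, and the minor is
    its monomial times the determinant. *)
Lemma minor_edge_gens (phi : 'I_d -> 'I_#|X|) :
  \det (rowsub phi (jacobian edge_gens)) = 0 \/
  exists V T (k : K), admissible E L V T /\
    \det (rowsub phi (jacobian edge_gens)) = k *: gmon K V T.
Proof.
pose psi i : Ix := enum_val (phi i).
have := det_jacobian_monomials (fun i : 'I_#|X| => enum_val i) phi.
rewrite -/edge_gens; set D := \det (rowsub _ _).
have -> : exp_matrix K ((fun i : 'I_#|X| =>
  enum_val i) \o phi) = exp_matrix K psi by [].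
have [-> DX|det0 DX] := eqVneq (\det (exp_matrix K psi)) 0.
  left; apply: (mulIf (mpolyX_neq0 (mesym1 setT))).
  by rewrite DX mpolyC0 mulr0 mul0r.
right; pose V := [set i | inr i \in codom psi].
pose T := [set e | inl e \in codom psi].
have psiX i : psi i \in X by exact: enum_valP.
have VTP x : x \in gen_set V T <-> exists i, x = psi i.
  by split; case: x => [e|v]; rewrite !inE => /codomP.
have TE : T \subset E.
  by apply/subsetP => e; rewrite inE => /codomP[i ei]; have := psiX i;
    rewrite -ei inE.
have VL : V \subset L.
  by apply/subsetP => v; rewrite inE => /codomP[i vi]; have := psiX i;
    rewrite -vi inE.
have rV := rooted_forest_of_det (simple_sub TE) (bip_sub TE) two_neq0 det0 VTP.
have adm : admissible E L V T.
  (* [V] is non-empty because some vertex exists, by [L_neq0], and its component meets [V]. *)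
  have [forT compT] := rV; split=> //; have /set0Pn[i _] := L_neq0.
  have : [set j | connect (adj T) i j] \in components T by apply/imsetP;
    exists i.
  move=> /compT; apply: contra_eq_neq => ->.
  by rewrite setI0 cards0.
have injpsi : injective psi.
  move=> i j pij; have [w wP] := exp_matrix_unit_dual i det0.
  have := wP j; rewrite -pij wP eqxx; case: eqP => // _ /eqP.
  by rewrite oner_eq0.
exists V, T, (\det (exp_matrix K psi)); split=> //.
apply: (mulIf (mpolyX_neq0 (mesym1 setT)));
  rewrite DX -scalerAl (gmon_gen_set adm).
have -> : gen_set V T = [set psi i | i in 'I_d].
  apply/setP => x; apply/idP/imsetP => [/VTP[i ->]|[i _ ->]]; first by exists i.
  by apply/VTP; exists i.
by rewrite big_imset /= => [|i j _ _ /injpsi//]; rewrite mulrC mul_mpolyC.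
Qed.

(** The rooted forest has exactly [d] generators, and the determinant of their exponents is a
    nonzero scalar that can be divided out. *)
Lemma gmon_minor V T : admissible E L V T ->
  exists (phi : 'I_d -> 'I_#|X|) (k : K),
    gmon K V T = k *: \det (rowsub phi (jacobian edge_gens)).
Proof.
move=> adm; have [_ VL TE _ _] := adm; have cX := card_admissible adm.
pose psi (i : 'I_d) : Ix := enum_val (cast_ord (esym cX) i).
have psiVT i : psi i \in gen_set V T by exact: enum_valP.
have psiX i : psi i \in X.
  have := psiVT i; rewrite !inE; case: (psi i) => [e|v].
    exact: (subsetP TE).
  exact: (subsetP VL).
have injpsi : injective psi by move=> i j /enum_val_inj/cast_ord_inj.
pose phi i := enum_rank_in (psiX i) (psi i).
have phiE i : enum_val (phi i) = psi i by rewrite enum_rankK_in.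
exists phi, (\det (exp_matrix K psi))^-1.
have det0 : \det (exp_matrix K psi) != 0.
  by apply: exp_matrix_rooted_forest (admissible_rooted adm) injpsi psiVT;
    [exact: simple_sub | exact: bip_sub | exact: two_neq0].
have := det_jacobian_monomials (fun i : 'I_#|X| => enum_val i) phi.
rewrite -/edge_gens (_ : exp_matrix K _ = exp_matrix K psi); last first.
  by apply/matrixP => i j; rewrite !mxE /= phiE.
set D := \det (rowsub _ _) => DX.
apply: (mulIf (mpolyX_neq0 (mesym1 setT))).
rewrite -scalerAl DX [X in _ *: X]mulrC mul_mpolyC scalerA mulVf //
  scale1r (gmon_gen_set adm).
rewrite (eq_bigr (fun i => 'X_[gen_exp (psi i)])) => [|i _];
  last by rewrite phiE.
have -> : gen_set V T = [set psi i | i in 'I_d].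
  apply/esym/eqP; rewrite eqEcard cX card_imset // card_ord leqnn andbT.
  by apply/subsetP => _ /imsetP[i _ ->].
by rewrite big_imset //= => i j _ _ /injpsi.
Qed.

Lemma subalg_minor_gmon f :
  subalg (jacobian_minor edge_gens) f <-> subalg (@gmon_gens K d E L) f.
Proof.
split; apply: subalg_mono => {}f.
  case=> rows [_ ->]; have [->|[V [T [k [adm ->]]]]] := minor_edge_gens rows.
    by rewrite -mpolyC0; exact: subalg_const.
  by apply: (subalgebra_scale (subalg_subalgebra _)); apply: subalg_gen;
    exists V, T.
case=> V [T [adm ->]]; have [phi [k ->]] := gmon_minor adm.
by apply: (subalgebra_scale (subalg_subalgebra _)); exact: minor_subalg.
Qed.

(** Any presentation has degree [2], so its forms and the edge and loop monomials are linear
    combinations of each other, and the minors generate the same algebra. *)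
Lemma gauss_algebra_edge_ring (meetL : meets_every_component E L) B :
  is_gauss_algebra A B <-> generates (@gmon_gens K d E L) B.
Proof.
split=> [[_ [n [g [k [gk gA gB]]]]]|BP]; last first.
  split; first exact/(edge_ring_dim K L simpleE bipE).
  exists #|X|, edge_gens, 2%N; split; first exact: edge_gens_homog.
    exact: edge_gens_generate.
  by move=> f; rewrite -BP; apply: subalg_minor_gmon.
have hA f : subalg (fun f =>
  f \in edge_gens) f <-> A f by exact: edge_gens_generate.
have gh f : subalg (fun f => f \in g) f <-> subalg (fun f => f \in edge_gens) f.
  by rewrite hA gA.
(* The square of a variable in [L] is the nonzero form on which the degrees are compared. *)
have k2 : k = 2%N.
  have /set0Pn[i iL] := L_neq0.
  apply: (homog_presentation (f := 'X_i ^+ 2) _ edge_gens_homog gk gh) => //.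
  - by rewrite mpolyXn dhomogX /= mdegMn mdeg1.
  - by rewrite mpolyXn mpolyX_neq0.
  by apply/hA/subalg_gen; right; exists i.
rewrite {k}k2 in gk.
move=> f; rewrite -subalg_minor_gmon -gB; split; apply: minors_subalg => i;
  apply: (@homog_linear_part 2%N) => //; try exact: edge_gens_homog.
  exact/gh/subalg_gen/mem_tnth.
exact/gh/subalg_gen/mem_tnth.
Qed.

(** The factors [x_V] and [x_{V^c}] are common, so [e_T] and [e_{T'}] are compared, whose exponents
    are the degrees. *)
Lemma gmon_eq_degree V T T' : admissible E L V T -> admissible E L V T' ->
  (gmon K V T = gmon K V T' <-> forall i, degree T i = degree T' i).
Proof.
move=> adm adm'; have degE T0 i : degree T0 i = (\sum_(e in T0) mesym1 e)%MM i.
  rewrite mnm_sumE /degree -sum1_card big_mkcond [RHS]big_mkcond.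
  by apply: eq_bigr => e _; rewrite mnmE inE; case: (e \in T0).
have -> : (forall i, degree T i = degree T' i) <->
    (\sum_(e in T) mesym1 e = \sum_(e in T') mesym1 e)%MM.
  split=> [dT|sT i]; last by rewrite !degE sT.
  by apply/mnmP => i; rewrite -!degE.
split=> [gE|sE]; last by rewrite /gmon sE.
have := gmonE K adm'; rewrite -gE (gmonE K adm) !mprodXE.
move=> /(mulfI (mpolyX_neq0 _)) /(congr1 (@msupp _ _)).
by rewrite !msuppX => -[].
Qed.

(** * Minimal generators when [L] is a single vertex *)

Lemma gmon_homog V T : admissible E L V T -> gmon K V T \is d.-homog.
Proof.
move=> adm; have := gmon_gen_set adm; rewrite /gmon dhomogX /=.
set m := (_ - _)%MM; rewrite mprodXE -mpolyXD.
move=> /(congr1 (fun f => mdeg (head 0%MM (msupp f)))).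
rewrite !msuppX /= mdegD mdeg_mesym1 cardsT card_ord mdeg_sum.
rewrite (eq_bigr (fun=> 2%N)) => [|x].
  (* The [d] quadratic generators have total degree [2d], and dividing by [x_1 ... x_d] leaves
     [d]. *)
  rewrite sum_nat_const (card_admissible adm) muln2 -addnn => /eqP.
  by rewrite eqn_add2r.
have [_ _ /subsetP TE _ _] := adm; case: x => [e|i]; rewrite inE /=.
  by move=> /TE/simpleE; rewrite mdeg_mesym1.
by rewrite mdegMn mdeg1.
Qed.

(** Each component meets [V = {v}], so every vertex is joined to [v]. *)
Lemma admissible1P v V T : L = [set v] ->
  admissible E L V T <-> V = L /\ T \in spanning_trees E.
Proof.
move=> Lv; have compE i : [set j | connect (adj T) i j] \in components T.
  by apply/imsetP; exists i.
split=> [[V0 VL TE forT compT]|[-> ]].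
  have VE : V = L.
    by move: VL V0; rewrite Lv subset1 => /orP[/eqP->//|->].
  split=> //; rewrite inE TE forT /=.
  have toV i : connect (adj T) i v.
    have /eqP/cards1P[u iu] := compT _ (compE i).
    have : u \in [set j | connect (adj T) i j] :&: V by rewrite iu set11.
    by rewrite !inE VE Lv in_set1 => /andP[iu' /eqP <-].
  apply/forallP => i; apply/forallP => j; apply: connect_trans (toV i) _.
  by rewrite connect_adjC.
rewrite inE => /and3P[TE forT /forallP conT]; split=> // C.
case/imsetP => i _ ->; rewrite Lv (_ : _ :&: _ = [set v]) ?cards1 //.
apply/setP => j; rewrite !inE andbC; case: eqP => //= ->.
exact: (forallP (conT i)).
Qed.

Lemma minimal_generators_sub (B : S -> Prop) (s s' : seq S) :
  minimal_homogeneous_generators B s -> {subset s' <= s} ->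
  (forall f, f \in s -> subalg (fun g => g \in s') f) -> {subset s <= s'}.
Proof.
move=> [_ _ genB minB] ss' gens'; apply: minB => // f; rewrite -genB; split.
  by apply: subalg_mono => g gs'; apply/subalg_gen/ss'.
exact: subalg_mono.
Qed.

(* If the algebra is generated in the single degree [k], the graded Nakayama
   lemma makes a minimal system a basis of the degree [k] part. *)
Lemma minimal_generators_size k n (t : n.-tuple S) (B : S -> Prop) (s : seq S) :
  (0 < k)%N -> (forall i, tnth t i \is k.-homog) ->
  generates (fun f => f \in t) B ->
  minimal_homogeneous_generators B s -> (size s <= n)%N.
Proof.
move=> k0 tk tB minB; have [us hs sB _] := minB.
have st f : f \in s -> subalg (fun g => g \in t) f.
  by move=> fs; apply/tB/sB/subalg_gen.
have lows f : f \in s -> low_free k f.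
  move=> /st/(linear_part k0) [g /tnthP[i ->]|//].
  exact/homog_low_free/tk.
(* Generators of another degree are redundant: each member of [t] is a combination of the degree [k]
   members of [s]. *)
have sk f : f \in s -> f \is k.-homog.
  have : {subset s <= [seq g <- s | g \is k.-homog]}.
    apply: (minimal_generators_sub minB) => [g|g /st].
      by rewrite mem_filter => /andP[].
    apply: subalg_mono => _ /tnthP[i ->].
    have ts : subalg (fun g => g \in in_tuple s) (tnth t i).
      by apply/sB/tB/subalg_gen/mem_tnth.
    have [_ [a tE]] := linear_part k0 (s := in_tuple s) lows ts.
    have -> : tnth t i = \sum_(j | tnth (in_tuple s) j \is k.-homog)
        a j *: tnth (in_tuple s) j.
      apply/mpolyP => m; rewrite raddf_sum /=.
      under eq_bigr do rewrite mcoeffZ.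
      have [mk|mk] := eqVneq (mdeg m) k; last first.
        rewrite (dhomog_nemf_coeff (tk i)) // big1 // => j jk.
        by rewrite (dhomog_nemf_coeff jk) ?mulr0.
      rewrite tE // [RHS]big_mkcond /=; apply: eq_bigr => j _; case: ifPn => // jk.
      have [e je] := hs _ (mem_tnth j (in_tuple s)).
      rewrite (dhomog_nemf_coeff je) ?mulr0 //= mk.
      by apply: contra jk => /eqP->.
    apply: (subalgebra_sum (subalg_subalgebra _)) => j jk.
    apply: (subalgebra_scale (subalg_subalgebra _)); apply: subalg_gen.
    by rewrite mem_filter jk mem_tnth.
  by move=> sub /sub; rewrite mem_filter => /andP[].
(* If [size s] exceeded [n], the members of [s], all combinations of [n] forms, would be linearly
   dependent, and one with nonzero coefficient could be dropped. *)
rewrite leqNgt; apply/negP => ns.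
have := @fin_all_exists 'I_(size s) (fun=> 'I_n -> K)
  (fun j c => tnth (in_tuple s) j = \sum_i c i *: tnth t i).
case=> [j|C CE].
  by apply: (homog_linear_part k0 tk); [apply: sk|apply: st]; apply: mem_tnth.
pose M : 'M[K]_(size s, n) := \matrix_(j, i) C j i.
have kM : kermx M != 0.
  by rewrite kermx_eq0 -row_leq_rank -ltnNge (leq_ltn_trans (rank_leq_col M)).
have /rowV0Pn[u /sub_kermxP uM u0] := kM.
have us0 : \sum_j u 0 j *: tnth (in_tuple s) j = 0.
  under eq_bigr do rewrite CE scaler_sumr.
  rewrite exchange_big big1 // => i _.
  under eq_bigr do rewrite scalerA.
  rewrite -scaler_suml (_ : \sum_j _ = 0) ?scale0r //.
  have := congr1 (fun v : 'rV_n => v 0 i) uM; rewrite !mxE => uMi.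
  by rewrite -[RHS]uMi; apply: eq_bigr => j _; rewrite mxE.
have [j uj] : exists j, u 0 j != 0.
  apply/existsP; apply: contraR u0; rewrite negb_exists => /forallP uz.
  by apply/eqP/rowP => j; rewrite mxE; apply/eqP/negbNE.
have ne (f : S) : f \in s -> f != tnth (in_tuple s) j ->
    subalg (fun g => g \in rem (tnth (in_tuple s) j) s) f.
  by move=> fs fj; apply: subalg_gen; rewrite mem_rem_uniq // !inE fj.
suff /(_ (tnth (in_tuple s) j) (mem_tnth j (in_tuple s))) :
    {subset s <= rem (tnth (in_tuple s) j) s}.
  by rewrite mem_rem_uniq // !inE eqxx.
apply: (minimal_generators_sub minB) => [f|f fs]; first exact: mem_rem.
have [->|fj] := eqVneq f (tnth (in_tuple s) j); last first.
  exact: ne.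
have jE : tnth (in_tuple s) j =
    \sum_(i | i != j) (- (u 0 j)^-1 * u 0 i) *: tnth (in_tuple s) i.
  move: us0; rewrite (bigD1 j) //= => /eqP; rewrite addr_eq0 => /eqP uE.
  rewrite -[LHS]scale1r -(mulVf uj) -scalerA uE scalerN -scaleNr scaler_sumr.
  by apply: eq_bigr => i _; rewrite scalerA.
rewrite [X in subalg _ X]jE.
apply: (subalgebra_sum (subalg_subalgebra _)) => i ij.
have nij : tnth (in_tuple s) i != tnth (in_tuple s) j.
  by rewrite !(tnth_nth 0) nth_uniq.
apply: (subalgebra_scale (subalg_subalgebra _)).
exact: (ne _ (mem_tnth i (in_tuple s)) nij).
Qed.

(** Spanning trees index the generators, possibly with repetition, since two trees can share their
    degrees. *)
Lemma minimal_generators_card B (s : seq S) : #|L| = 1%N ->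
  generates (@gmon_gens K d E L) B ->
  minimal_homogeneous_generators B s -> (size s <= #|spanning_trees E|)%N.
Proof.
move=> /eqP/cards1P[v Lv] BP.
pose t := [tuple gmon K L (enum_val i) | i < #|spanning_trees E|].
apply: (@minimal_generators_size d _ t).
- exact: leq_ltn_trans (ltn_ord v).
- move=> i; rewrite tnth_mktuple; apply: gmon_homog.
  by apply/(admissible1P _ _ Lv); split=> //; exact: enum_valP.
move=> f; rewrite -BP; split; apply: subalg_mono => {}f.
  case/tnthP => i ->; rewrite tnth_mktuple; apply: subalg_gen.
  exists L, (enum_val i); split=> //.
  by apply/(admissible1P _ _ Lv); split=> //; exact: enum_valP.
case=> V [T [/(admissible1P _ _ Lv)[-> TT] ->]]; apply: subalg_gen.
apply/tnthP; exists (enum_rank_in TT T).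
by rewrite tnth_mktuple enum_rankK_in.
Qed.

End EdgeRing.

End Gauss.

Theorem theorem4p3 (K : fieldType) (charK : [pchar K] =i pred0)
    (d r : nat) (E : {set {set 'I_d}}) (L : {set 'I_d})
    (simpleE : simple_graph E) (bipE : bipartite E)
    (compE : #|components E| = r) (L_neq0 : L != set0) :
  let A : {mpoly K[d]} -> Prop := @edge_ring K d E L in
  (has_krull_dim A d <-> meets_every_component E L) /\
  (meets_every_component E L ->
    [/\ forall B : {mpoly K[d]} -> Prop,
          is_gauss_algebra A B <-> generates (@gmon_gens K d E L) B,
        #|L| = 1%N ->
          forall B : {mpoly K[d]} -> Prop, is_gauss_algebra A B ->
          forall s : seq {mpoly K[d]}, minimal_homogeneous_generators B s ->
            (size s <= #|spanning_trees E|)%N &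
        forall (V : {set 'I_d}) (T T' : {set {set 'I_d}}),
          admissible E L V T -> admissible E L V T' ->
          (gmon K V T = gmon K V T' <->
           forall i : 'I_d, degree T i = degree T' i)]).
Proof.
have [c bipc] := bipE.
move=> A; split; first exact: (edge_ring_dim K L simpleE bipc).
move=> meetL; split.
- exact: (gauss_algebra_edge_ring charK simpleE bipc L_neq0 meetL).
- move=> L1 B /(gauss_algebra_edge_ring charK simpleE bipc L_neq0 meetL) BP s.
  exact: (minimal_generators_card charK simpleE bipc L_neq0 L1 BP).
exact: gmon_eq_degree.
Qed.
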